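(* Let $\delta\in(0,1]$ and run the algorithm CB-MNL with the convex confidence set $E_t(\delta)$ as decision set (described in the context) for $T$ rounds, with regularization parameter $\lambda_t=d\log(KT)$ for all $t\in[T]$ (where $KT\ge 2$). Then, with probability at least $1-\delta$, $$\mathbf R_T=\mathrm O\big(d\sqrt T\,\log(KT)+\kappa\, d^2\log^2(KT)\big),$$ where the $\mathrm O(\cdot)$ constant depends only on $S$ and $\delta$ (and not on $d,K,N,T,\kappa$).
   Context: **Model.** There are $N$ items, indexed by $[N]=\{1,\dots,N\}$, a dimension $d$, a maximum assortment size $K$ and a horizon $T$. At each round $t$ the learner is shown context vectors $x_{t,1},\dots,x_{t,N}\in\mathbb R^d$ (possibly chosen adversarially, depending on the past), then chooses an assortment $\mathcal Q_t\subset[N]$ with $|\mathcal Q_t|\le K$, based on the history (past contexts, assortments and responses, and the current contexts). She observes $r_t\in\{0,1\}^N$ with $r_{t,i}=0$ for $i\notin\mathcal Q_t$ and $\sum_{i\in\mathcal Q_t}r_{t,i}\le 1$; conditionally on the history and $\mathcal Q_t$, $r_{t,i}=1$ with probability $\mu_i(\mathbf X_{\mathcal Q_t}^\top\theta_* )$ for $i\in\mathcal Q_t$. Here, for an assortment $\mathcal Q$ at round $t$, $\mathbf X_{\mathcal Q}$ is the matrix with columns $x_{t,i}$, $i\in\mathcal Q$, and $$\mu_i(\mathbf X_{\mathcal Q}^\top\theta)=\frac{\exp(x_{t,i}^\top\theta)}{1+\sum_{j\in\mathcal Q}\exp(x_{t,j}^\top\theta)},\quad \mu(\mathbf X_{\mathcal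 Q}^\top\theta)=\sum_{i\in\mathcal Q}\mu_i(\mathbf X_{\mathcal Q}^\top\theta),\quad \mu_0(\mathbf X_{\mathcal Q}^\top\theta)=1-\mu(\mathbf X_{\mathcal Q}^\top\theta).$$ $\theta_*\in\mathbb R^d$ is unknown and fixed. **Assumptions.** $\theta_*\in\Theta$ with $\Theta\subset\mathbb R^d$ compact, $S=\max_{\theta\in\Theta}\|\theta\|_2$, and $\|x_{t,i}\|_2\le 1$ for all $t,i$. There is $\kappa>0$ such that $\mu_i(\mathbf X_{\mathcal Q}^\top\theta)(1-\mu_i(\mathbf X_{\mathcal Q}^\top\theta))\ge 1/\kappa$ for all rounds, all assortments $\mathcal Q$ with $|\mathcal Q|\le K$, all $i\in\mathcal Q$ and all $\theta\in\Theta$. $L\le 1$ is an upper bound on the first derivative of the softmax functions $\mu_i$ along any component. **Regret.** $\mathbf R_T=\sum_{t=1}^T[\mu(\mathbf X_{\mathcal Q_t^*}^\top\theta_* )-\mu(\mathbf X_{\mathcal Q_t}^\top\theta_* )]$, where $\mathcal Q_t^*$ maximizes $\mu(\mathbf X_{\mathcal Q}^\top\theta_* )$ over assortments $\mathcal Q\subset[N]$ with $|\mathcal Q|\le K$ at round $t$. **Estimator and confidence set.** The regularized log-likelihood is $$\mathcal L_t^{\lambda_t}(\theta)=\sum_{s=1}^{t-1}\Big[\sum_{i\in\mathcal Q_s}r_{s,i}\log\mu_i(\mathbf X_{\mathcal Q_s}^\top\theta)+\Big(1-\sum_{i\in\mathcal Q_s}r_{s,i}\Big)\log\mu_0(\mathbf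 X_{\mathcal Q_s}^\top\theta)\Big]-\frac{\lambda_t}{2}\|\theta\|_2^2,$$ and $\hat\theta_t$ is its maximizer over $\mathbb R^d$. Let $$\gamma_t(\delta)=\sqrt{\lambda_t}\Big(S+\tfrac12\Big)+\frac{2}{\sqrt{\lambda_t}}\log\!\Big(\frac{(\lambda_t+LKt/d)^{d/2}\lambda_t^{-d/2}}{\delta}\Big)+\frac{2d}{\sqrt{\lambda_t}}\log 2,\qquad \beta_t(\delta)=\gamma_t(\delta)+\frac{\gamma_t^2(\delta)}{\lambda_t},$$ $$E_t(\delta)=\{\theta\in\Theta:\ \mathcal L_t^{\lambda_t}(\hat\theta_t)-\mathcal L_t^{\lambda_t}(\theta)\le\beta_t^2(\delta)\}.$$ **Algorithm CB-MNL with $E_t(\delta)$.** At each round $t$, it computes $\hat\theta_t$ and $E_t(\delta)$ and plays $\mathcal Q_t$, where $(\mathcal Q_t,\theta_t)\in\arg\max_{A\in\mathcal A,\ \theta\in E_t(\delta)}\mu(\mathbf X_A^\top\theta)$ and $\mathcal A$ is the set of all assortments of cardinality at most $K$. *)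

(* Defs.v *)
From HB Require Import structures.
From mathcomp Require Import all_boot all_order all_algebra.
From mathcomp Require Import all_classical all_reals all_analysis.

Set Implicit Arguments.
Unset Strict Implicit.
Unset Printing Implicit Defensive.

Import Order.TTheory GRing.Theory Num.Theory.
Import numFieldNormedType.Exports.

Local Open Scope classical_set_scope.
Local Open Scope ring_scope.

(* The library norm on matrices is the sup norm. *)
Definition norm2 (R : realType) (d : nat) (v : 'cV[R]_d) : R :=
  Num.sqrt (\sum_k v k 0 ^+ 2).

(* The contexts of one round are the columns of a matrix X : 'M_(d, N), so
   X^T *m theta lists the utilities of all N items; softmax Q only looks at the
   entries indexed by Q, and is meant to be used at i \in Q. *)
Definition softmax (R : realType) (N : nat) (Q : {set 'I_N}) (i : 'I_N)
    (z : 'cV[R]_N) : R :=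
  expR (z i 0) / (1 + \sum_(j in Q) expR (z j 0)).

Definition mu_item (R : realType) (d N : nat) (X : 'M[R]_(d, N))
    (Q : {set 'I_N}) (theta : 'cV[R]_d) (i : 'I_N) : R :=
  softmax Q i (X^T *m theta).

Definition mu (R : realType) (d N : nat) (X : 'M[R]_(d, N))
    (Q : {set 'I_N}) (theta : 'cV[R]_d) : R :=
  \sum_(i in Q) mu_item X Q theta i.

Definition mu_none (R : realType) (d N : nat) (X : 'M[R]_(d, N))
    (Q : {set 'I_N}) (theta : 'cV[R]_d) : R :=
  1 - mu X Q theta.

Definition opt_assortment (R : realType) (d N K : nat) (X : 'M[R]_(d, N))
    (theta : 'cV[R]_d) : {set 'I_N} :=
  [arg max_(A > (finset.set0 : {set 'I_N}) | (#|A| <= K)%N) mu X A theta]%O.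

Definition regret (R : realType) (d N K T : nat) (theta_star : 'cV[R]_d)
    (X : nat -> 'M[R]_(d, N)) (Q : nat -> {set 'I_N}) : R :=
  \sum_(1 <= t < T.+1)
    (mu (X t) (opt_assortment K (X t) theta_star) theta_star
     - mu (X t) (Q t) theta_star).

Definition log_lik (R : realType) (d N : nat) (lam : nat -> R)
    (X : nat -> 'M[R]_(d, N)) (Q : nat -> {set 'I_N})
    (r : nat -> 'I_N -> bool) (t : nat) (theta : 'cV[R]_d) : R :=
  \sum_(1 <= s < t)
    (\sum_(i in Q s) (r s i)%:R * ln (mu_item (X s) (Q s) theta i)
     + (1 - \sum_(i in Q s) (r s i)%:R) * ln (mu_none (X s) (Q s) theta))
  - lam t / 2 * norm2 theta ^+ 2.

Definition gamma (R : realType) (d K : nat) (S L : R) (lam : nat -> R)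
    (delta : R) (t : nat) : R :=
  Num.sqrt (lam t) * (S + 1 / 2)
  + 2 / Num.sqrt (lam t)
    * ln ((lam t + L * K%:R * t%:R / d%:R) `^ (d%:R / 2)
          * lam t `^ (- (d%:R / 2)) / delta)
  + 2 * d%:R / Num.sqrt (lam t) * ln 2.

Definition beta (R : realType) (d K : nat) (S L : R) (lam : nat -> R)
    (delta : R) (t : nat) : R :=
  gamma d K S L lam delta t + gamma d K S L lam delta t ^+ 2 / lam t.

Definition conf_set (R : realType) (d N K : nat) (Theta : set 'cV[R]_d)
    (S L : R) (lam : nat -> R) (delta : R)
    (X : nat -> 'M[R]_(d, N)) (Q : nat -> {set 'I_N})
    (r : nat -> 'I_N -> bool) (theta_hat : 'cV[R]_d) (t : nat) :
    set 'cV[R]_d :=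
  [set theta | Theta theta /\
    log_lik lam X Q r t theta_hat - log_lik lam X Q r t theta
      <= beta d K S L lam delta t ^+ 2].

(* Sigma-algebra generated by the contexts and assortments of rounds 1..t and
   by the responses of rounds 1..t-1, i.e. by what precedes the response r_t. *)
Definition history (R : realType) (d N : nat) (disp : measure_display)
    (Omega : measurableType disp)
    (X : nat -> Omega -> 'M[R]_(d, N)) (Q : nat -> Omega -> {set 'I_N})
    (r : nat -> Omega -> 'I_N -> bool) (t : nat) : set (set Omega) :=
  <<s [set A | exists s k i (B : set R), [/\ (1 <= s <= t)%N, measurable B &
                 A = [set w | B (X s w k i)]]]
      `|` [set A | exists s (Q0 : {set 'I_N}), (1 <= s <= t)%N /\
                 A = [set w | Q s w = Q0]]
      `|` [set A | exists s i, (1 <= s < t)%N /\ A = [set w | r s w i]] >>.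

(* p is a version of the conditional probability of the event E given the
   sub-sigma-algebra G. *)
Definition is_cond_prob (R : realType) (disp : measure_display)
    (Omega : measurableType disp) (P : probability Omega R)
    (G : set (set Omega)) (E : set Omega) (p : Omega -> R) : Prop :=
  (forall B : set R, measurable B -> G (p @^-1` B)) /\
  (forall A, G A -> P (A `&` E) = \int[P]_(w in A) (p w)%:E)%E.

(* The contexts X t w are arbitrary random variables (they may depend on the
   past and on extra randomness); only the law of the response given the history
   and the chosen assortment is prescribed. *)
Record mnl_model (R : realType) (d N K T : nat) (kappa L S : R)
    (Theta : set 'cV[R]_d) (theta_star : 'cV[R]_d)
    (disp : measure_display) (Omega : measurableType disp)
    (P : probability Omega R)
    (X : nat -> Omega -> 'M[R]_(d, N)) (Q : nat -> Omega -> {set 'I_N})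
    (r : nat -> Omega -> 'I_N -> bool) : Prop := MnlModel {
  model_compact : compact Theta ;
  model_theta_star : Theta theta_star ;
  model_S_ub : forall theta, Theta theta -> norm2 theta <= S ;
  model_S_attained : exists2 theta, Theta theta & norm2 theta = S ;
  model_kappa_gt0 : 0 < kappa ;
  model_kappa : forall t w (A : {set 'I_N}) i theta,
    (1 <= t <= T)%N -> (#|A| <= K)%N -> i \in A -> Theta theta ->
    1 / kappa <= mu_item (X t w) A theta i * (1 - mu_item (X t w) A theta i) ;
  model_L_le1 : L <= 1 ;
  model_L : forall (A : {set 'I_N}) i j (z : 'cV[R]_N),
    (#|A| <= K)%N -> i \in A -> j \in A ->
    'D_(delta_mx j 0) (softmax A i : 'cV[R]_N -> R^o) z <= L ;
  model_context_meas : forall t k i, (1 <= t <= T)%N ->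
    measurable_fun [set: Omega] (fun w => X t w k i) ;
  model_context_norm : forall t w i, (1 <= t <= T)%N ->
    norm2 (col i (X t w)) <= 1 ;
  model_assortment_meas : forall t (A : {set 'I_N}), (1 <= t <= T)%N ->
    measurable [set w | Q t w = A] ;
  model_assortment_card : forall t w, (1 <= t <= T)%N -> (#|Q t w| <= K)%N ;
  model_response_meas : forall t i, (1 <= t <= T)%N ->
    measurable [set w | r t w i] ;
  model_response_supp : forall t w i, (1 <= t <= T)%N ->
    i \notin Q t w -> r t w i = false ;
  model_response_single : forall t w, (1 <= t <= T)%N ->
    (\sum_(i in Q t w) r t w i <= 1)%N ;
  model_response_law : forall t i, (1 <= t <= T)%N ->
    is_cond_prob P (history X Q r t) [set w | r t w i]
      (fun w => if i \in Q t w then mu_item (X t w) (Q t w) theta_star i else 0)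
}.

(* One run of the algorithm, i.e. the sequences seen along one sample point.
   The joint maximization over assortments and E_t(delta) is meaningful only if
   E_t(delta) is nonempty; otherwise the assortment played is unconstrained. *)
Definition cb_mnl_run (R : realType) (d N K T : nat) (Theta : set 'cV[R]_d)
    (S L : R) (lam : nat -> R) (delta : R)
    (X : nat -> 'M[R]_(d, N)) (Q : nat -> {set 'I_N})
    (r : nat -> 'I_N -> bool) (theta_hat theta_opt : nat -> 'cV[R]_d) : Prop :=
  forall t, (1 <= t <= T)%N ->
    (forall theta,
       log_lik lam X Q r t theta <= log_lik lam X Q r t (theta_hat t)) /\
    (let E := conf_set K Theta S L lam delta X Q r (theta_hat t) t in
     E !=set0 ->
     E (theta_opt t) /\
     forall (A : {set 'I_N}) theta, (#|A| <= K)%N -> E theta ->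
       mu (X t) A theta <= mu (X t) (Q t) (theta_opt t)).

(* Main.v *)
(* The regret is in fact of order [d * sqrt T * ln (K * T)]: since the utilities
   are bounded by [S], all choice probabilities of a round with assortment [Q] are
   comparable, up to factors depending on [S], to [1 / (1 + #|Q|)], and the term
   in [kappa] only adds slack.

   Coverage of E_t(delta).  For a fixed [theta] the likelihood ratio against
   [theta_star] is a nonnegative martingale of mean 1, hence so is its mixture
   over a prior, and by Ville's inequality the mixture stays below [1 / delta]
   forever with probability at least [1 - delta].  With a discretised Gaussian prior of
   precision [lam], and since the log-likelihood has Hessian at least
   [- (lam + t)], the mixture dominates the regularised maximum likelihood up to a
   factor [(C * sqrt (1 + t / lam)) ^ d], which the radius beta_t absorbs.

   Regret.  If [theta_star] and [theta_t] both lie in E_t(delta), strong concavity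
   of the log-likelihood at their midpoint bounds [theta_t - theta_star] in the
   norm of [lam * I + \sum_(s < t) W_s], with [W_s] the sum of the [x x^T] over the
   assortment divided by [(1 + #|Q|) ^ 2].  By optimism the regret of a round is
   at most a constant times the [W_t]-norm of [theta_t - theta_star], and these
   norms are summed by replacing [W_t] with a rank-one minorant attaining the same
   value and applying the elliptical potential lemma. *)
Require Import Defs.
From HB Require Import structures.
From mathcomp Require Import all_boot all_order all_algebra.
From mathcomp Require Import all_classical all_reals all_analysis.
From mathcomp Require Import measurable_realfun ring lra.
Import Order.TTheory GRing.Theory Num.Theory.
Import numFieldNormedType.Exports.
Local Open Scope classical_set_scope.
Local Open Scope ring_scope.

(** The prior lives on a finite grid so that mixing commutes with expectation, and it is a product
    so that the comparison with a paraboloid splits by coordinates. Ville's inequality needs one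
    prior for all rounds, so the grid must resolve the sharpest precision [lam + T] and reach every
    maximiser; the a priori bound on [theta_hat] depends on [N] and [T], but only the size of the
    grid feels it. The good event is the survival of the mixture, which is measurable by itself;
    coverage is then deterministic on it. The delicate point is the size of the radius. Its
    logarithm contains [L * K * t / (d * lam)] where the mixture produces [t / lam]; the missing
    factor [d] is made up for by [lam = d * ln (K * T)] and by the slack [lam / 4] in [gamma ^ 2],
    and [L >= 1 / 4] is extracted from the softmax of a single item. Curvature is handled through
    second differences [F (x + v) + F (x - v) - 2 F x], so no gradient or Hessian of the likelihood
    appears. *)

(** * Elementary inequalities *)

Lemma ge0_derive_le {R : realType} (f df : R -> R) (x : R) :
  (forall y : R, is_derive y (1 : R) f (df y)) -> (forall y, 0 <= y -> 0 <= df y) ->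
  0 <= x -> f 0 <= f x.
Proof.
move=> fd df0 x0.
have fc : {within `[0, x], continuous f}.
  apply: derivable_within_continuous => y _; exact: ex_derive.
have [c] := MVT_segment x0 (fun y _ => fd y) fc.
rewrite in_itv /= subr0 => /andP[c0 _] fE.
by rewrite -subr_ge0 fE mulr_ge0 ?df0.
Qed.

Lemma expR_le_expRN {R : realType} (y : R) : 0 <= y -> expR (- y) <= expR y.
Proof. by move=> y0; rewrite ler_expR; lra. Qed.

(** For [x >= 0], adding [(1 + x / 2) ^+ 2 <= expR x] and [1 - x <= expR (- x)] cancels the linear
    terms. *)
Lemma expR_cosh_ge {R : realType} (x : R) :
  2 + x ^+ 2 / 4 <= expR x + expR (- x).
Proof.
wlog x0 : x / 0 <= x.
  move=> H; have [/H//|/ltW x0] := leP 0 x.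
  by have := H (- x); rewrite sqrrN opprK [expR (- x) + _]addrC; apply; lra.
have := expR_ge1Dx (- x).
have : (1 + x / 2) ^+ 2 <= expR (x / 2) ^+ 2.
  by rewrite ler_sqr ?nnegrE ?expR_ge0 ?expR_ge1Dx//; lra.
rewrite -expRM_natr divfK// => ?; lra.
Qed.

(** The function [cosh z * exp (- z^2 / 2)] decreases for [z >= 0]: its derivative has the sign of
    [sinh z - z * cosh z], which starts at 0 and has derivative [- z * sinh z]. *)
Lemma expR_cosh_le {R : realType} (x : R) :
  expR x + expR (- x) <= 2 * expR (x ^+ 2 / 2).
Proof.
wlog x0 : x / 0 <= x.
  move=> H; have [/H//|/ltW x0] := leP 0 x.
  by have := H (- x); rewrite sqrrN opprK [expR (- x) + _]addrC; apply; lra.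
have sinh_le (y : R) : 0 <= y ->
    0 <= y * (expR y + expR (- y)) - (expR y - expR (- y)).
  move=> y0.
  pose f z : R := z * (expR z + expR (- z)) - (expR z - expR (- z)).
  suff : f 0 <= f y by rewrite {1}/f oppr0 subrr mul0r subr0.
  apply: (@ge0_derive_le _ _ (fun z => z * (expR z - expR (- z)))) => //.
  - move=> z; apply: is_derive_eq; rewrite /= ?/GRing.scale /=; ring.
  - by move=> z z0; rewrite mulr_ge0// subr_ge0 expR_le_expRN.
suff : (expR x + expR (- x)) * expR (- (x ^+ 2 / 2)) <= 2.
  by rewrite [expR (- (_ / _))]expRN ler_pdivrMr ?expR_gt0.
pose f z : R := 2 - (expR z + expR (- z)) * expR (- (z ^+ 2 / 2)).
suff : f 0 <= f x.
  by rewrite /f oppr0 expr0n /= mul0r oppr0 expR0; lra.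
apply: (@ge0_derive_le _ _ (fun z => expR (- (z ^+ 2 / 2)) *
   (z * (expR z + expR (- z)) - (expR z - expR (- z))))) => //.
- move=> z; apply: is_derive_eq; rewrite /= ?/GRing.scale /=; by field.
- by move=> z z0; rewrite mulr_ge0 ?expR_ge0 ?sinh_le //.
Qed.

Lemma ln1D_ge {R : realType} (x : R) : 0 <= x -> x / (1 + x) <= ln (1 + x).
Proof.
move=> x0; have := @le_ln1Dx R (- (x / (1 + x))).
have -> : 1 - x / (1 + x) = (1 + x)^-1 by field; rewrite gt_eqF//; lra.
rewrite lnV ?posrE//; last by lra.
rewrite lerN2; apply; rewrite ltrN2 ltr_pdivrMr; lra.
Qed.

Lemma cauchy_schwarz_sum {R : realType} {I : finType} (P : pred I)
    (x y : I -> R) :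
  (\sum_(i | P i) x i * y i) ^+ 2 <=
  (\sum_(i | P i) x i ^+ 2) * (\sum_(i | P i) y i ^+ 2).
Proof.
(* Lagrange's identity: this double sum is twice the defect in the inequality. *)
have : 0 <= \sum_(i | P i) \sum_(j | P j) (x i * y j - x j * y i) ^+ 2.
  by apply: sumr_ge0 => i _; apply: sumr_ge0 => j _; exact: sqr_ge0.
have -> : \sum_(i | P i) \sum_(j | P j) (x i * y j - x j * y i) ^+ 2 =
    2 * ((\sum_(i | P i) x i ^+ 2) * (\sum_(i | P i) y i ^+ 2)
         - (\sum_(i | P i) x i * y i) ^+ 2).
  transitivity (\sum_(i | P i) \sum_(j | P j)
      (x i ^+ 2 * y j ^+ 2 + y i ^+ 2 * x j ^+ 2
       - 2 * ((x i * y i) * (x j * y j)))).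
    by apply: eq_bigr => i _; apply: eq_bigr => j _; ring.
  under eq_bigr do rewrite sumrB big_split /= -!mulr_sumr.
  rewrite sumrB big_split /= -!mulr_suml -mulr_sumr -mulr_suml; ring.
by rewrite pmulr_rge0// subr_ge0.
Qed.

(** * Log-partition function of the multinomial logit model *)

Section LogitSum.
Context {R : realType} {I : finType}.
Implicit Types (Q : {set I}) (z a : I -> R).

Definition logit_sum Q z : R := 1 + \sum_(j in Q) expR (z j).

Lemma logit_sum_ge1 Q z : 1 <= logit_sum Q z.
Proof. by rewrite lerDl sumr_ge0// => j _; rewrite expR_ge0. Qed.

Lemma logit_sum_gt0 Q z : 0 < logit_sum Q z.
Proof. exact: lt_le_trans (logit_sum_ge1 Q z). Qed.

(** In the expanded product the cross term is at least the square of the sum of the [expR (z j)] by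
    Cauchy-Schwarz, and each pair of linear terms gains [expR (z j) * a j ^+ 2 / 4]. The linear
    terms exist thanks to the constant 1 of the outside option, so there is a gain even when all
    [a j] coincide. *)
Lemma logit_sum_midpoint_ge Q z a :
  logit_sum Q z ^+ 2 + (\sum_(j in Q) expR (z j) * a j ^+ 2) / 4 <=
  logit_sum Q (z \+ a) * logit_sum Q (z \- a).
Proof.
have cs : (\sum_(j in Q) expR (z j)) ^+ 2 <=
    (\sum_(j in Q) expR (z j + a j)) * (\sum_(j in Q) expR (z j - a j)).
  have half (x : R) : expR (x / 2) ^+ 2 = expR x by rewrite -expRM_natr divfK.
  have := cauchy_schwarz_sum (mem Q) (fun j => expR ((z j + a j) / 2))
            (fun j => expR ((z j - a j) / 2)).
  rewrite (eq_bigr (fun j => expR (z j))) => [|j _]; last first.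
    by rewrite -expRD; congr expR; field.
  rewrite [X in _ <= X * _ -> _](eq_bigr (fun j => expR (z j + a j)));
    last by move=> j _; exact: half.
  by rewrite [X in _ <= _ * X -> _](eq_bigr (fun j => expR (z j - a j)))
    => [|j _]; last exact: half.
have ch : 2 * \sum_(j in Q) expR (z j) + (\sum_(j in Q) expR (z j) * a j ^+ 2) / 4
    <= \sum_(j in Q) expR (z j + a j) + \sum_(j in Q) expR (z j - a j).
  rewrite mulr_sumr mulr_suml -!big_split /=; apply: ler_sum => j _.
  rewrite !expRD; have := expR_cosh_ge (a j); have := expR_gt0 (z j); nra.
rewrite /logit_sum /=; nra.
Qed.

(** By AM-GM it suffices to bound the sum of the two factors, where each exponential is multiplied
    by at most [2 cosh alpha <= 2 exp (alpha^2 / 2)]. *)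
Lemma logit_sum_midpoint_le Q z a (alpha : R) :
  (forall j, j \in Q -> `|a j| <= alpha) ->
  logit_sum Q (z \+ a) * logit_sum Q (z \- a) <=
  logit_sum Q z ^+ 2 * expR (alpha ^+ 2).
Proof.
move=> aalpha.
set c := expR alpha + expR (- alpha).
have c2 : 2 <= c.
  by rewrite /c; have := expR_cosh_ge alpha; have := sqr_ge0 alpha; lra.
have ch : logit_sum Q (z \+ a) + logit_sum Q (z \- a) <= c * logit_sum Q z.
  rewrite /logit_sum mulrDr mulr1 mulr_sumr addrACA -big_split /=.
  apply: lerD; first by lra.
  apply: ler_sum => j /aalpha; rewrite ler_norml => /andP[al au].
  (* [(e^alpha - y) (y - e^(-alpha)) >= 0] for [y = e^(a_j)] gives
     [y + 1 / y <= e^alpha + e^(-alpha)] *)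
  have : 0 <= (expR alpha - expR (a j)) * (expR (a j) - expR (- alpha)).
    by rewrite mulr_ge0// subr_ge0 ler_expR.
  have : expR alpha * expR (- alpha) = 1 by rewrite -expRD subrr expR0.
  have : expR (a j) * expR (- a j) = 1 by rewrite -expRD subrr expR0.
  have := expR_gt0 (- a j); have := expR_gt0 (z j).
  rewrite !expRD /c.
  move: (expR (z j)) (expR (a j)) (expR (- a j)) (expR alpha) (expR (- alpha)).
  move=> w y y' u u' w0 y'0 yy uu h.
  have : y' * ((u - y) * (y - u')) = (u + u' - y - y') by ring: yy uu.
  have := mulr_ge0 (ltW y'0) h; nra.
have chle : c <= 2 * expR (alpha ^+ 2 / 2) by exact: expR_cosh_le.
have -> : expR (alpha ^+ 2) = expR (alpha ^+ 2 / 2) ^+ 2.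
  by rewrite -expRM_natr divfK.
set E := expR _ in chle *; set N := logit_sum Q z in ch *.
have AB : logit_sum Q (z \+ a) + logit_sum Q (z \- a) <= 2 * (N * E).
  apply: le_trans ch _; rewrite [N * E]mulrC mulrA ler_wpM2r//.
  exact: ltW (logit_sum_gt0 _ _).
have A0 := logit_sum_gt0 Q (z \+ a); have B0 := logit_sum_gt0 Q (z \- a).
have := sqr_ge0 (logit_sum Q (z \+ a) - logit_sum Q (z \- a)).
have : (logit_sum Q (z \+ a) + logit_sum Q (z \- a)) ^+ 2 <= (2 * (N * E)) ^+ 2.
  by rewrite ler_sqr ?nnegrE//; lra.
rewrite -exprMn; lra.
Qed.

End LogitSum.

Lemma expR_sub_le {R : realType} (x y S : R) :
  y <= S -> expR y - expR x <= expR S * `|y - x|.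
Proof.
rewrite -ler_expR => yS.
have -> : expR x = expR y * expR (x - y) by rewrite -expRD; congr expR; ring.
have h : expR y * (1 - expR (x - y)) <= expR y * `|y - x|.
  rewrite ler_wpM2l ?expR_ge0//.
  by have := expR_ge1Dx (x - y); have := ler_norm (y - x); lra.
have := ler_wpM2r (normr_ge0 (y - x)) yS; lra.
Qed.

(** * Euclidean norm and quadratic lower bounds at a maximiser *)

Section Norm2.
Context {R : realType} {d : nat}.
Implicit Types v : 'cV[R]_d.

Lemma norm2_ge0 v : 0 <= norm2 v.
Proof. exact: sqrtr_ge0. Qed.

Lemma sqr_norm2 v : norm2 v ^+ 2 = \sum_k v k 0 ^+ 2.
Proof. by rewrite sqr_sqrtr// sumr_ge0// => k _; rewrite sqr_ge0. Qed.

Lemma norm2Z (c : R) v : norm2 (c *: v) ^+ 2 = c ^+ 2 * norm2 v ^+ 2.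
Proof.
by rewrite !sqr_norm2 mulr_sumr; apply: eq_bigr => k _; rewrite mxE exprMn.
Qed.

Lemma norm20 : norm2 (0 : 'cV[R]_d) = 0.
Proof. by rewrite /norm2 big1 ?sqrtr0// => k _; rewrite mxE expr0n. Qed.

Lemma norm2_parallelogram v u :
  norm2 (v + u) ^+ 2 + norm2 (v - u) ^+ 2 = 2 * norm2 v ^+ 2 + 2 * norm2 u ^+ 2.
Proof.
rewrite !sqr_norm2 !mulr_sumr -!big_split; apply: eq_bigr => k _.
by rewrite /= !mxE; ring.
Qed.

(* A function that is midpoint-convex up to a quadratic and bounded above by its
   value at [x0] lies above the paraboloid at [x0]: halving the step doubles the
   defect at most, while the defect is quadratic. *)
Lemma maximizer_lower_bound (F : 'cV[R]_d -> R) (A : R) (x0 v : 'cV[R]_d) :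
  (forall x u, 2 * F x - A * norm2 u ^+ 2 <= F (x + u) + F (x - u)) ->
  (forall x, F x <= F x0) ->
  F x0 - A / 2 * norm2 v ^+ 2 <= F (x0 + v).
Proof.
move=> Fmid Fmax.
pose psi u := F (x0 + u) - F x0 + A / 2 * norm2 u ^+ 2.
have psi_ge u : - (A / 2 * norm2 u ^+ 2) <= psi u.
  have := Fmid x0 u; have := Fmax (x0 - u); rewrite /psi; lra.
have psi_half u : 2 * psi (2^-1 *: u) <= psi u.
  have := Fmid (x0 + 2^-1 *: u) (2^-1 *: u).
  rewrite addrK -addrA -scalerDl.
  have -> : 2^-1 + 2^-1 = 1 :> R by field.
  rewrite scale1r /psi norm2Z; lra.
have psi_iter n : 2 ^+ n * psi (2^-1 ^+ n *: v) <= psi v.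
  elim: n => [|n IH]; first by rewrite !expr0 mul1r scale1r.
  apply: le_trans IH; rewrite exprSr -mulrA ler_wpM2l ?exprn_ge0//.
  by rewrite exprS -scalerA psi_half.
suff : 0 <= psi v by rewrite /psi; lra.
apply/ler_addgt0Pr => e e0.
set B := A / 2 * norm2 v ^+ 2.
have [n Bn] : exists n, `|B| / e < 2 ^+ n.
  exists (Num.Def.trunc (`|B| / e)).+1.
  apply: (@lt_le_trans _ _ (Num.Def.trunc (`|B| / e)).+1%:R).
    by apply: truncnS_gt.
  by rewrite -natrX ler_nat ltnW// ltn_expl.
have : 2 ^+ n * psi (2^-1 ^+ n *: v) >= - (`|B| / 2 ^+ n).
  have := psi_ge (2^-1 ^+ n *: v); rewrite norm2Z => h.
  have n0 : 0 < 2 ^+ n :> R by rewrite exprn_gt0.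
  rewrite -(ler_pM2l n0) in h; apply: le_trans h.
  have -> : 2 ^+ n * - (A / 2 * ((2^-1 ^+ n) ^+ 2 * norm2 v ^+ 2)) =
      - (B / 2 ^+ n).
    by rewrite /B exprVn; field; rewrite gt_eqF.
  by rewrite lerN2 ler_pM2r ?invr_gt0// ler_norm.
have : `|B| / 2 ^+ n <= e.
  rewrite ler_pdivrMr ?exprn_gt0// mulrC -ler_pdivrMr//; exact: ltW.
have := psi_iter n; lra.
Qed.

End Norm2.

(** * One round: choice probabilities, log-likelihood, information *)

Section Rounds.
Context {R : realType} {d N : nat}.
Implicit Types (X : 'M[R]_(d, N)) (Q : {set 'I_N}) (theta v : 'cV[R]_d).

Definition utility X theta (i : 'I_N) : R := (X^T *m theta) i 0.

Lemma utilityE X theta i : utility X theta i = \sum_k X k i * theta k 0.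
Proof. by rewrite /utility mxE; apply: eq_bigr => k _; rewrite mxE. Qed.

Lemma utilityD X theta v :
  utility X (theta + v) = utility X theta \+ utility X v.
Proof. by apply/funext => i; rewrite /= /utility mulmxDr mxE. Qed.

Lemma utilityB X theta v :
  utility X (theta - v) = utility X theta \- utility X v.
Proof. by apply/funext => i; rewrite /= /utility mulmxBr mxE [X in _ + X]mxE. Qed.

Lemma utilityZ X c v i : utility X (c *: v) i = c * utility X v i.
Proof. by rewrite /utility -scalemxAr mxE. Qed.

Lemma utility_le X v i : norm2 (col i X) <= 1 -> `|utility X v i| <= norm2 v.
Proof.
move=> Xi; rewrite -ler_sqr ?nnegrE ?norm2_ge0// real_normK ?num_real//.
rewrite utilityE; apply: le_trans (cauchy_schwarz_sum _ _ _) _.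
rewrite -[X in _ <= X]mul1r -sqr_norm2 ler_wpM2r ?sqr_ge0//.
have -> : \sum_k X k i ^+ 2 = norm2 (col i X) ^+ 2.
  by rewrite sqr_norm2; apply: eq_bigr => k _; rewrite mxE.
by rewrite expr_le1// norm2_ge0.
Qed.

Lemma mu_itemE X Q theta i :
  mu_item X Q theta i = expR (utility X theta i) / logit_sum Q (utility X theta).
Proof. by []. Qed.

Lemma muE X Q theta : mu X Q theta = 1 - (logit_sum Q (utility X theta))^-1.
Proof.
rewrite /mu; under eq_bigr do rewrite mu_itemE.
rewrite -mulr_suml.
have := logit_sum_gt0 Q (utility X theta).
have -> : \sum_(i in Q) expR (utility X theta i) =
          logit_sum Q (utility X theta) - 1 by rewrite /logit_sum; lra.
by move=> h; field; rewrite gt_eqF.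
Qed.

Lemma mu_noneE X Q theta :
  mu_none X Q theta = (logit_sum Q (utility X theta))^-1.
Proof. by rewrite /mu_none muE opprB addrC subrK. Qed.

Definition round_log_lik X Q (r : 'I_N -> bool) theta : R :=
  \sum_(i in Q) (r i)%:R * ln (mu_item X Q theta i)
  + (1 - \sum_(i in Q) (r i)%:R) * ln (mu_none X Q theta).

Lemma round_log_likE X Q r theta :
  round_log_lik X Q r theta =
  \sum_(i in Q) (r i)%:R * utility X theta i - ln (logit_sum Q (utility X theta)).
Proof.
rewrite /round_log_lik mu_noneE lnV ?posrE ?logit_sum_gt0//.
have -> : \sum_(i in Q) (r i)%:R * ln (mu_item X Q theta i) =
    \sum_(i in Q) (r i)%:R * utility X theta i
    - (\sum_(i in Q) (r i)%:R) * ln (logit_sum Q (utility X theta)).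
  rewrite mulr_suml -sumrB; apply: eq_bigr => i _.
  rewrite mu_itemE ln_div ?posrE ?expR_gt0 ?logit_sum_gt0// expRK; ring.
ring.
Qed.

(** The response term is linear in the parameter and cancels, so the curvature is that of the
    log-partition function alone. *)
Lemma round_log_lik_midpoint X Q r theta v :
  round_log_lik X Q r (theta + v) + round_log_lik X Q r (theta - v) =
  2 * round_log_lik X Q r theta
  - (ln (logit_sum Q (utility X (theta + v)) * logit_sum Q (utility X (theta - v)))
     - 2 * ln (logit_sum Q (utility X theta))).
Proof.
rewrite lnM ?posrE ?logit_sum_gt0// !round_log_likE.
have -> : \sum_(i in Q) (r i)%:R * utility X (theta + v) i =
   \sum_(i in Q) (r i)%:R * utility X theta i
   + \sum_(i in Q) (r i)%:R * utility X v i.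
  by rewrite -big_split; apply: eq_bigr => i _; rewrite utilityD /= mulrDr.
have -> : \sum_(i in Q) (r i)%:R * utility X (theta - v) i =
   \sum_(i in Q) (r i)%:R * utility X theta i
   - \sum_(i in Q) (r i)%:R * utility X v i.
  by rewrite -sumrB; apply: eq_bigr => i _; rewrite utilityB /= mulrBr.
ring.
Qed.

Lemma round_log_lik_midpoint_ge X Q r theta v :
  (forall i, i \in Q -> norm2 (col i X) <= 1) ->
  2 * round_log_lik X Q r theta - norm2 v ^+ 2 <=
  round_log_lik X Q r (theta + v) + round_log_lik X Q r (theta - v).
Proof.
move=> X1; rewrite round_log_lik_midpoint lerD2l lerN2 lerBlDr.
have N0 := logit_sum_gt0 Q (utility X theta).
have -> : norm2 v ^+ 2 + 2 * ln (logit_sum Q (utility X theta)) =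
    ln (logit_sum Q (utility X theta) ^+ 2 * expR (norm2 v ^+ 2)).
  by rewrite lnM ?posrE ?exprn_gt0 ?expR_gt0// lnXn// expRK; ring.
rewrite ler_ln ?posrE ?mulr_gt0 ?exprn_gt0 ?expR_gt0 ?logit_sum_gt0//.
rewrite utilityD utilityB; apply: logit_sum_midpoint_le => j jQ.
by apply: utility_le; exact: X1.
Qed.

(* Up to factors depending only on the bound on the utilities, the information
   [mu_0 * \sum_i mu_i x_i x_i^T] carried by a round. *)
Definition round_info X Q v : R :=
  (\sum_(i in Q) utility X v i ^+ 2) / (1 + #|Q|%:R) ^+ 2.

Lemma round_info_ge0 X Q v : 0 <= round_info X Q v.
Proof.
by rewrite divr_ge0 ?sqr_ge0// sumr_ge0// => i _; rewrite sqr_ge0.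
Qed.

Lemma logit_sum_le Q (z : 'I_N -> R) (S : R) : 0 <= S ->
  (forall j, j \in Q -> `|z j| <= S) ->
  (1 + #|Q|%:R) * expR (- S) <= logit_sum Q z <= (1 + #|Q|%:R) * expR S.
Proof.
move=> S0 zS; rewrite /logit_sum !mulrDl !mul1r !mulr_natl.
rewrite -!sumr_const; apply/andP; split; apply: lerD.
- by rewrite -expR0 ler_expR; lra.
- by apply: ler_sum => j /zS; rewrite ler_norml ler_expR => /andP[].
- by rewrite -expR0 ler_expR; lra.
- by apply: ler_sum => j /zS; rewrite ler_norml ler_expR => /andP[].
Qed.

(** The weights are at least [expR (- S)] and the normaliser is at most [(1 + #|Q|) * expR S];
    together they give [expR (- (3 * S))], uniformly in the size of the assortment. The factor
    [1 + S ^+ 2] is the price of [ln (1 + y) >= y / (1 + y)] with [y <= S ^+ 2]. *)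
Lemma round_log_lik_midpoint_le X Q r theta v (S : R) : 0 <= S ->
  (forall i, i \in Q -> `|utility X theta i| <= S) ->
  (forall i, i \in Q -> `|utility X v i| <= S) ->
  round_log_lik X Q r (theta + v) + round_log_lik X Q r (theta - v) <=
  2 * round_log_lik X Q r theta
  - expR (- (3 * S)) / (4 * (1 + S ^+ 2)) * round_info X Q v.
Proof.
move=> S0 zS vS; rewrite round_log_lik_midpoint lerD2l lerN2.
set N0 := logit_sum Q (utility X theta).
have N0_gt0 : 0 < N0 by exact: logit_sum_gt0.
have n_gt0 : 0 < 1 + #|Q|%:R :> R by rewrite ltr_pwDl.
set I := round_info X Q v.
have I0 : 0 <= I by exact: round_info_ge0.
have IS : I <= S ^+ 2.
  rewrite /I /round_info ler_pdivrMr ?exprn_gt0//.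
  apply: (@le_trans _ _ (\sum_(i in Q) S ^+ 2)).
    apply: ler_sum => i /vS ?; rewrite -[_ ^+ 2]real_normK ?num_real//.
    by rewrite ler_sqr ?nnegrE//.
  rewrite sumr_const -[_ *+ _]mulr_natr ler_wpM2l ?sqr_ge0//.
  have := ler0n R #|Q|; have := sqr_ge0 (#|Q|%:R : R); lra.
set y := expR (- (3 * S)) / 4 * I.
have e1 : expR (- (3 * S)) <= 1 by rewrite expR_le1; lra.
have e0 := expR_gt0 (- (3 * S)).
have y0 : 0 <= y by rewrite /y mulr_ge0// divr_ge0// ltW.
have yS : y <= S ^+ 2 by rewrite /y; nra.
have prod_ge : N0 ^+ 2 * (1 + y) <=
    logit_sum Q (utility X (theta + v)) * logit_sum Q (utility X (theta - v)).
  rewrite utilityD utilityB.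
  apply: le_trans (logit_sum_midpoint_ge _ _ _).
  rewrite mulrDr mulr1 lerD2l.
  have w_ge : expR (- S) * \sum_(j in Q) utility X v j ^+ 2 <=
      \sum_(j in Q) expR (utility X theta j) * utility X v j ^+ 2.
    rewrite mulr_sumr; apply: ler_sum => j /zS.
    rewrite ler_norml => /andP[h _].
    by rewrite ler_wpM2r ?sqr_ge0// ler_expR.
  have /andP[_ N0_le] := logit_sum_le _ _ _ S0 zS; rewrite -/N0 in N0_le.
  have sI : \sum_(j in Q) utility X v j ^+ 2 = I * (1 + #|Q|%:R) ^+ 2.
    by rewrite /I /round_info divfK// expf_neq0// gt_eqF.
  have : N0 ^+ 2 <= ((1 + #|Q|%:R) * expR S) ^+ 2.
    by rewrite ler_sqr ?nnegrE// ?ltW// mulr_gt0// expR_gt0.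
  move=> N2; rewrite sI in w_ge.
  have : N0 ^+ 2 * y <= ((1 + #|Q|%:R) * expR S) ^+ 2 * y by rewrite ler_wpM2r.
  have -> : ((1 + #|Q|%:R) * expR S) ^+ 2 * y =
      expR (- S) * (I * (1 + #|Q|%:R) ^+ 2) / 4.
    have -> : expR (- S) = expR S ^+ 2 * expR (- (3 * S)).
      by rewrite -expRM_natr -expRD; congr expR; ring.
    by rewrite /y; field.
  lra.
have : ln (N0 ^+ 2 * (1 + y)) <= ln (logit_sum Q (utility X (theta + v))
    * logit_sum Q (utility X (theta - v))).
  by rewrite ler_ln// posrE mulr_gt0 ?exprn_gt0 ?logit_sum_gt0//; lra.
rewrite lnM ?posrE ?exprn_gt0//; last by lra.
rewrite lnXn// -[_ *+ 2]mulr_natl => lnge.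
have lny := ln1D_ge y y0.
have yle : y / (1 + S ^+ 2) <= y / (1 + y).
  by rewrite ler_wpM2l// lef_pV2 ?posrE ?lerD2l//; have := sqr_ge0 S; lra.
have -> : expR (- (3 * S)) / (4 * (1 + S ^+ 2)) * I = y / (1 + S ^+ 2).
  by rewrite /y; field; rewrite gt_eqF//; have := sqr_ge0 S; lra.
lra.
Qed.

(** By [muE] this is a difference of inverse normalisers, and both normalisers are at least of order
    [1 + #|Q|]. Passing from the sum of absolute utilities to the root of the sum of squares costs
    the root of [#|Q|], less than one of these two factors, so no power of [K] survives. *)
Lemma mu_sub_le X Q theta theta' (S : R) : 0 <= S ->
  (forall i, i \in Q -> `|utility X theta i| <= S) ->
  (forall i, i \in Q -> `|utility X theta' i| <= S) ->
  mu X Q theta' - mu X Q theta <=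
  expR (3 * S) * Num.sqrt (round_info X Q (theta' - theta)).
Proof.
move=> S0 zS z'S; rewrite !muE.
have /andP[Nge _] := logit_sum_le _ _ _ S0 zS.
have /andP[N'ge _] := logit_sum_le _ _ _ S0 z'S.
have N_gt0 := logit_sum_gt0 Q (utility X theta).
have N'_gt0 := logit_sum_gt0 Q (utility X theta').
have n_gt0 : 0 < 1 + #|Q|%:R :> R by rewrite ltr_pwDl.
set D := \sum_(i in Q) `|utility X (theta' - theta) i|.
have D0 : 0 <= D by apply: sumr_ge0.
have diff : logit_sum Q (utility X theta') - logit_sum Q (utility X theta)
    <= expR S * D.
  rewrite /logit_sum opprD addrACA subrr add0r -sumrB mulr_sumr.
  apply: ler_sum => i iQ; rewrite utilityB /=.
  by apply: expR_sub_le; have := z'S i iQ; rewrite ler_norml => /andP[].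
have info : D / (1 + #|Q|%:R) ^+ 2 <= Num.sqrt (round_info X Q (theta' - theta)).
  rewrite -ler_sqr ?nnegrE ?sqrtr_ge0 ?divr_ge0 ?sqr_ge0//.
  rewrite sqr_sqrtr ?round_info_ge0// /round_info.
  have := cauchy_schwarz_sum (mem Q) (fun i => `|utility X (theta' - theta) i|)
     (fun=> 1).
  rewrite (eq_bigr (fun i => `|utility X (theta' - theta) i|)) => [|i _];
    last by rewrite mulr1.
  rewrite [X in _ <= X * _ -> _](eq_bigr (fun i => utility X (theta' - theta) i ^+ 2))
    => [|i _]; last by rewrite real_normK ?num_real.
  rewrite expr1n sumr_const -/D => cs.
  rewrite expr_div_n ler_pdivrMr ?exprn_gt0//; apply: le_trans cs _.
  set SX := \sum_(i in Q) _.
  have -> : SX / (1 + #|Q|%:R) ^+ 2 * ((1 + #|Q|%:R) ^+ 2) ^+ 2 =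
      SX * (1 + #|Q|%:R) ^+ 2 by field; rewrite gt_eqF.
  rewrite ler_wpM2l//; last first.
    by have := ler0n R #|Q|; have := sqr_ge0 (#|Q|%:R : R); lra.
  by rewrite sumr_ge0// => i _; rewrite sqr_ge0.
apply: le_trans (ler_wpM2l (expR_ge0 _) info).
have -> : 1 - (logit_sum Q (utility X theta'))^-1
    - (1 - (logit_sum Q (utility X theta))^-1) =
   (logit_sum Q (utility X theta') - logit_sum Q (utility X theta)) /
   (logit_sum Q (utility X theta') * logit_sum Q (utility X theta)).
  by field; rewrite !gt_eqF.
rewrite ler_pdivrMr ?mulr_gt0//; apply: le_trans diff _.
have : ((1 + #|Q|%:R) * expR (- S)) ^+ 2 <=
  logit_sum Q (utility X theta') * logit_sum Q (utility X theta).
  by rewrite expr2 ler_pM// mulr_ge0 ?expR_ge0// ltW.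
move=> NN; have : 0 <= expR (3 * S) * (D / (1 + #|Q|%:R) ^+ 2).
  by rewrite mulr_ge0 ?expR_ge0// divr_ge0// sqr_ge0.
move=> /ler_wpM2l/(_ _ _ NN); apply: le_trans.
have -> : expR (3 * S) = expR S / expR (- S) ^+ 2.
  by rewrite -expRM_natr -expRN -expRD; congr expR; ring.
rewrite le_eqVlt; apply/orP; left; apply/eqP.
by field; rewrite !gt_eqF ?expR_gt0.
Qed.

End Rounds.

(** * Elliptical potential lemma *)

Section EllipticalPotential.
Context {R : realType}.

Definition quad {n} (U : 'M[R]_n) (v : 'cV[R]_n) : R := (v^T *m U *m v) 0 0.

Definition dot {n} (u v : 'cV[R]_n) : R := (u^T *m v) 0 0.

Lemma dotE {n} (u v : 'cV[R]_n) : dot u v = \sum_i u i 0 * v i 0.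
Proof. by rewrite /dot mxE; apply: eq_bigr => i _; rewrite mxE. Qed.

Lemma dotC {n} (u v : 'cV[R]_n) : dot u v = dot v u.
Proof. by rewrite !dotE; apply: eq_bigr => i _; rewrite mulrC. Qed.

Lemma dot_norm2 {n} (u : 'cV[R]_n) : dot u u = norm2 u ^+ 2.
Proof. by rewrite dotE sqr_norm2. Qed.

Lemma dot_sqr_le {n} (u v : 'cV[R]_n) :
  dot u v ^+ 2 <= norm2 u ^+ 2 * norm2 v ^+ 2.
Proof. by rewrite dotE !sqr_norm2 cauchy_schwarz_sum. Qed.

Definition sym_pos_def {n} (U : 'M[R]_n) : Prop :=
  U^T = U /\ forall v, v != 0 -> 0 < quad U v.

Lemma quad_ge0 {n} (U : 'M[R]_n) v : sym_pos_def U -> 0 <= quad U v.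
Proof.
move=> [_ Upos]; have [->|/Upos/ltW//] := eqVneq v 0.
by rewrite /quad mulmx0 mxE.
Qed.

Lemma sym_pos_def_diag_gt0 {n} (U : 'M[R]_n) i : sym_pos_def U -> 0 < U i i.
Proof.
move=> [_ /(_ (delta_mx i 0))].
have -> : quad U (delta_mx i 0) = U i i.
  by rewrite /quad trmx_delta -rowE -colE !mxE.
apply; apply/eqP => /matrixP/(_ i 0); rewrite !mxE !eqxx => /eqP.
by rewrite oner_eq0.
Qed.

Lemma det_add1_rank1 {n} (u v : 'cV[R]_n) :
  \det (1%:M + u *m v^T) = 1 + dot v u.
Proof.
(* Two factorisations of one bordered matrix: eliminating either diagonal block gives one side of
   the identity. *)
pose B := block_mx (1%:M : 'M[R]_1) (- v^T) u (1%:M : 'M[R]_n).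
have B1 : B = block_mx 1%:M 0 u 1%:M *m block_mx 1%:M (- v^T) 0 (1%:M + u *m v^T).
  by rewrite mulmx_block !mul1mx !mul0mx !mulmx1 ?mulmx0 !addr0 mulmxN
             [1%:M + _]addrC addrA addNr add0r.
have B2 : B = block_mx (1%:M + v^T *m u) (- v^T) 0 1%:M *m block_mx 1%:M 0 u 1%:M.
  by rewrite mulmx_block !mulmx1 ?mulmx0 ?mul0mx ?mul1mx !add0r mulNmx addrK.
rewrite -[LHS](_ : \det B = _); last first.
  by rewrite B1 det_mulmx det_lblock det_ublock !det1 !mul1r.
rewrite B2 det_mulmx det_lblock det_ublock !det1 !mulr1.
by rewrite det_mx11 mxE [X in X + _]mxE eqxx.
Qed.

Lemma det_rank1_update {n} (U : 'M[R]_n) (g : 'cV[R]_n) : U \in unitmx ->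
  \det (U + g *m g^T) = \det U * (1 + quad (invmx U) g).
Proof.
move=> Uu; have -> : U + g *m g^T = U *m (1%:M + (invmx U *m g) *m g^T).
  by rewrite mulmxDr mulmx1 !mulmxA mulmxV// mul1mx.
by rewrite det_mulmx det_add1_rank1 /dot /quad mulmxA.
Qed.

Lemma quad_invmx {n} (U : 'M[R]_n) (g : 'cV[R]_n) : U^T = U -> U \in unitmx ->
  quad (invmx U) g = quad U (invmx U *m g).
Proof.
by move=> Us Uu; rewrite /quad trmx_mul trmx_inv Us !mulmxA mulmxKV.
Qed.

(* Hadamard's inequality, by induction on Schur complements. *)
Lemma det_pos_def_hadamard n (U : 'M[R]_n) : sym_pos_def U ->
  0 < \det U <= \prod_i U i i.
Proof.
elim: n U => [|n IH] U Upd; first by rewrite det_mx00 big_ord0 ltr01 lexx.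
move: U Upd; rewrite -[n.+1]/(1 + n)%N => U Upd.
have [Us Upos] := Upd.
set a := U 0 0; set b : 'cV[R]_n := dlsubmx U; set D : 'M[R]_n := drsubmx U.
have a_gt0 : 0 < a by exact: sym_pos_def_diag_gt0.
have UE : U = block_mx a%:M b^T b D.
  rewrite -[LHS]submxK; congr block_mx.
    by rewrite [LHS]mx11_scalar; congr (_%:M); rewrite !mxE; congr (U _ _);
       apply: val_inj.
  by rewrite /b trmx_dlsub Us.
have Ds : D^T = D by rewrite /D trmx_drsub Us.
pose D' := D - a^-1 *: (b *m b^T).
have D's : D'^T = D' by rewrite /D' linearB /= linearZ /= trmx_mul trmxK Ds.
have D'pd : sym_pos_def D'.
  split=> // y y0.
  have := Upos (col_mx (- a^-1 *: (b^T *m y)) y).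
  have -> : quad U (col_mx (- a^-1 *: (b^T *m y)) y) = quad D' y.
    rewrite /quad UE -mulmxA mul_block_col tr_col_mx mul_row_col.
    have -> : a%:M *m (- a^-1 *: (b^T *m y)) + b^T *m y = 0.
      by rewrite mul_scalar_mx scalerA mulrN divff ?gt_eqF// scaleN1r addNr.
    rewrite mulmx0 add0r -[RHS]/((_ *m _ *m _) 0 0) -mulmxA.
    congr ((_ *m _) 0 0).
    by rewrite /D' mulmxBl -scalemxAr addrC scaleNr -scalemxAl mulmxA.
  apply; apply: contra y0 => /eqP/(congr1 dsubmx).
  by rewrite col_mxKd linear0 => ->.
have Dpd : sym_pos_def D.
  split=> // y y0; have := Upos (col_mx 0 y).
  have -> : quad U (col_mx 0 y) = quad D y.
    by rewrite /quad UE -mulmxA mul_block_col tr_col_mx mul_row_col !mulmx0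
               trmx0 mul0mx !add0r mulmxA.
  apply; apply: contra y0 => /eqP/(congr1 dsubmx).
  by rewrite col_mxKd linear0 => ->.
have /andP[D'0 _] := IH _ D'pd; have /andP[D0 D1] := IH _ Dpd.
have detU : \det U = a * \det D'.
  have -> : U = block_mx 1%:M 0 (a^-1 *: b) 1%:M *m block_mx a%:M b^T 0 D'.
    rewrite UE mulmx_block !mul1mx !mul0mx ?mulmx0 !addr0 -!scalemxAl.
    by rewrite mul_mx_scalar scalerA mulVf ?gt_eqF// scale1r /D' addrC subrK.
  by rewrite det_mulmx det_lblock det_ublock !det1 det_scalar1 !mul1r.
have D'u : D' \in unitmx by rewrite unitmxE unitfE gt_eqF.
(* [D] exceeds the Schur complement by a rank-one square, which can only raise the determinant. *)
have D'D : \det D' <= \det D.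
  have -> : D = D' + ((Num.sqrt a)^-1 *: b) *m ((Num.sqrt a)^-1 *: b)^T.
    rewrite linearZ /= -scalemxAl -scalemxAr scalerA -invfM -expr2.
    by rewrite sqr_sqrtr ?ltW// subrK.
  rewrite det_rank1_update//; apply: ler_peMr; first exact: ltW.
  by rewrite lerDl quad_invmx//; exact: quad_ge0.
rewrite detU mulr_gt0//= big_ord_recl -/a ler_pM2l//.
apply: le_trans D'D _; apply: le_trans D1 _.
rewrite le_eqVlt; apply/orP; left; apply/eqP; apply: eq_bigr => i _.
by rewrite !mxE; congr (U _ _); apply: val_inj.
Qed.

Lemma sym_pos_def_unit {n} (U : 'M[R]_n) : sym_pos_def U -> U \in unitmx.
Proof. by move=> /det_pos_def_hadamard/andP[h _]; rewrite unitmxE unitfE gt_eqF. Qed.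

(** Cauchy-Schwarz for the inner product of [U], applied to [y = invmx U *m g] and [v]: [U] is
    nonnegative on the residual of [v] after projection on [y]. *)
Lemma dot_sqr_le_quad {n} (U : 'M[R]_n) (g v : 'cV[R]_n) : sym_pos_def U ->
  dot g v ^+ 2 <= quad (invmx U) g * quad U v.
Proof.
move=> Upd; have [Us Upos] := Upd; have Uu := sym_pos_def_unit U Upd.
rewrite quad_invmx//; set y := invmx U *m g.
have gE : g = U *m y by rewrite /y mulKVmx.
clearbody y.
have [y0|y0] := eqVneq y 0.
  by rewrite gE y0 mulmx0 /dot trmx0 mul0mx mxE expr0n /= mulr_ge0 ?quad_ge0.
have x0 := Upos _ y0; set x := quad U y in x0 *.
have quadE (c : R) : quad U (v - c *: y) = quad U v - 2 * c * dot g v + c ^+ 2 * x.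
  have yUv : (y^T *m U *m v) 0 0 = dot g v.
    by rewrite /dot gE trmx_mul Us.
  have vUy : (v^T *m U *m y) 0 0 = dot g v.
    by rewrite dotC /dot gE mulmxA.
  have -> : quad U (v - c *: y) = quad U v - c * (v^T *m U *m y) 0 0
      - c * (y^T *m U *m v) 0 0 + c ^+ 2 * quad U y.
    rewrite /quad (_ : (v - c *: y)^T = v^T - c *: y^T); last first.
      by rewrite linearB /= linearZ.
    rewrite mulmxBr !mulmxBl -!scalemxAr -!scalemxAl.
    have sub (M M' : 'M[R]_1) : (M - M') 0 0 = M 0 0 - M' 0 0 by rewrite !mxE.
    have scale a (M : 'M[R]_1) : (a *: M) 0 0 = a * M 0 0 by rewrite mxE.
    by rewrite !(sub, scale); ring.
  rewrite yUv vUy /x; ring.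
have := quad_ge0 U (v - (dot g v / x) *: y) Upd.
rewrite quadE => h.
have : 0 <= x * (quad U v - 2 * (dot g v / x) * dot g v + (dot g v / x) ^+ 2 * x).
  by rewrite mulr_ge0// ltW.
have -> : x * (quad U v - 2 * (dot g v / x) * dot g v + (dot g v / x) ^+ 2 * x) =
   x * quad U v - dot g v ^+ 2 by field; rewrite gt_eqF.
by rewrite subr_ge0.
Qed.

Fixpoint gram {n} (lam : R) (g : nat -> 'cV[R]_n) (t : nat) : 'M[R]_n :=
  if t is s.+1 then gram lam g s + g s *m (g s)^T else lam%:M.

Lemma quad_gram {n} (lam : R) (g : nat -> 'cV[R]_n) t v :
  quad (gram lam g t) v = lam * norm2 v ^+ 2 + \sum_(s < t) dot (g s) v ^+ 2.
Proof.
elim: t => [|t IH] /=.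
  by rewrite big_ord0 addr0 /quad mul_mx_scalar -scalemxAl mxE -/(dot v v) dot_norm2.
rewrite big_ord_recr addrA -IH /= /quad mulmxDr mulmxDl mxE; congr (_ + _).
by rewrite !mulmxA -mulmxA mxE big_ord1 expr2 -/(dot (g t) v) -/(dot v (g t)) [dot v _]dotC.
Qed.

Lemma gram_sym_pos_def {n} (lam : R) (g : nat -> 'cV[R]_n) t : 0 < lam ->
  sym_pos_def (gram lam g t).
Proof.
move=> lam0; split.
  elim: t => [|t IH] /=; first by rewrite tr_scalar_mx.
  by rewrite linearD /= IH trmx_mul trmxK.
move=> v v0; rewrite quad_gram ltr_pwDl//; last first.
  by apply: sumr_ge0 => s _; exact: sqr_ge0.
rewrite mulr_gt0// lt_neqAle sqr_ge0 andbT eq_sym; apply: contra v0.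
rewrite sqr_norm2 psumr_eq0 => [/allP h|k _]; last exact: sqr_ge0.
apply/eqP/colP => i; rewrite mxE.
have := h i (mem_index_enum _); rewrite implyTb sqrf_eq0; exact: eqP.
Qed.

Lemma gram_diag_le {n} (lam : R) (g : nat -> 'cV[R]_n) t i :
  (forall s, norm2 (g s) <= 1) -> gram lam g t i i <= lam + t%:R.
Proof.
move=> g1; elim: t => [|t IH] /=; first by rewrite mxE eqxx addr0.
rewrite mxE -natr1 addrA lerD// mxE big_ord1 mxE -expr2.
have : g t i 0 ^+ 2 <= norm2 (g t) ^+ 2.
  by rewrite sqr_norm2 (bigD1 i)//= lerDl sumr_ge0// => k _; rewrite sqr_ge0.
by move=> /le_trans; apply; rewrite expr_le1// norm2_ge0.
Qed.

(** Each [D s] lies in the ellipsoid cut out by the earlier directions, so Cauchy-Schwarz leaves [b]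
    times the squared dual norm [x s] of [g s]. The factors [1 + x s] telescope to the determinant
    of the Gram matrix, which Hadamard bounds by its diagonal; [x <= lam^-1] gives
    [x <= (1 + lam^-1) * ln (1 + x)]. *)
Lemma elliptical_potential {n} (lam b : R) (g D : nat -> 'cV[R]_n) (t : nat) :
  0 < lam -> (forall s, norm2 (g s) <= 1) ->
  (forall s, (s < t)%N ->
    lam * norm2 (D s) ^+ 2 + \sum_(j < s) dot (g j) (D s) ^+ 2 <= b) ->
  \sum_(s < t) dot (g s) (D s) ^+ 2 <=
  b * (1 + lam^-1) * n%:R * ln (1 + t%:R / lam).
Proof.
move=> lam0 g1 Db.
have pd s := gram_sym_pos_def lam g s lam0.
pose x s := quad (invmx (gram lam g s)) (g s).
have x_ge0 s : 0 <= x s.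
  have [Us _] := pd s; rewrite /x quad_invmx ?sym_pos_def_unit//; exact: quad_ge0.
(* With [y] the dual vector, [lam * |y|^2 <= x] and [x^2 <= |y|^2], hence [lam * x^2 <= x]. *)
have x_le s : x s <= lam^-1.
  have [Us _] := pd s; have Uu := sym_pos_def_unit _ (pd s).
  set y := invmx (gram lam g s) *m g s.
  have xE : x s = quad (gram lam g s) y by rewrite /x quad_invmx.
  have xdot : x s = dot (g s) y by rewrite /x /quad /dot /y mulmxA.
  have lamy : lam * norm2 y ^+ 2 <= x s.
    by rewrite xE quad_gram lerDl sumr_ge0// => k _; rewrite sqr_ge0.
  have : x s ^+ 2 <= norm2 y ^+ 2.
    rewrite xdot; apply: le_trans (dot_sqr_le _ _) _.
    by rewrite ler_piMl ?sqr_ge0// expr_le1// norm2_ge0.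
  rewrite -[lam^-1]mul1r ler_pdivlMr//; have := x_ge0 s.
  move: (norm2 y ^+ 2) lamy => q; nra.
have detE s : ln (\det (gram lam g s)) =
    n%:R * ln lam + \sum_(j < s) ln (1 + x j).
  elim: s => [|s IH] /=; first by rewrite big_ord0 addr0 det_scalar lnXn// mulr_natl.
  rewrite det_rank1_update ?sym_pos_def_unit// lnM ?posrE.
  - by rewrite IH big_ord_recr /= addrA.
  - by have /andP[] := det_pos_def_hadamard _ _ (pd s).
  - by rewrite ltr_pwDl// x_ge0.
have sum_ln : \sum_(j < t) ln (1 + x j) <= n%:R * ln (1 + t%:R / lam).
  have /andP[d0 d1] := det_pos_def_hadamard _ _ (pd t).
  have : ln (\det (gram lam g t)) <= ln ((lam + t%:R) ^+ n).
    rewrite ler_ln ?posrE ?exprn_gt0//; last by rewrite ltr_pwDl.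
    apply: le_trans d1 _.
    rewrite -[X in _ ^+ X]card_ord -prodr_const; apply: ler_prod => i _.
    by rewrite gram_diag_le// andbT ltW// sym_pos_def_diag_gt0.
  have -> : lam + t%:R = lam * (1 + t%:R / lam) by field; rewrite gt_eqF.
  have t0 : 0 < 1 + t%:R / lam by rewrite ltr_pwDl// divr_ge0// ltW.
  rewrite detE lnXn ?mulr_gt0// lnM ?posrE// mulrnDl -!(mulr_natl (ln _)).
  by rewrite lerD2l.
have b0 s : (s < t)%N -> 0 <= b.
  move=> /Db; apply: le_trans; rewrite addr_ge0//.
    by rewrite mulr_ge0 ?sqr_ge0// ltW.
  by apply: sumr_ge0 => j _; exact: sqr_ge0.
have li0 : 0 < lam^-1 by rewrite invr_gt0.
apply: (@le_trans _ _ (\sum_(s < t) b * (1 + lam^-1) * ln (1 + x s))).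
  apply: ler_sum => s _; have bs := b0 s (ltn_ord s).
  apply: le_trans (dot_sqr_le_quad _ _ _ (pd s)) _; rewrite -/(x s).
  have xb : x s * quad (gram lam g s) (D s) <= x s * b.
    by rewrite ler_wpM2l// quad_gram Db.
  apply: le_trans xb _; rewrite mulrC -mulrA ler_wpM2l//.
  have := ln1D_ge _ (x_ge0 s); rewrite ler_pdivrMr; last first.
    by have := x_ge0 s; lra.
  move=> /le_trans; apply; rewrite mulrC ler_wpM2r ?lerD2l//.
  by rewrite ln_ge0// lerDl.
(* For [t = 0] nothing forces [0 <= b], but then both sides vanish. *)
rewrite -mulr_sumr -[X in _ <= X]mulrA; case: t Db b0 sum_ln => [|t] Db b0 sum_ln.
  by rewrite big_ord0 mul0r addr0 ln1 !mulr0.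
by rewrite ler_wpM2l// mulr_ge0 ?(b0 0%N)//; lra.
Qed.

End EllipticalPotential.

(** * Regret of the optimistic rule inside the confidence sets *)

Section Regret.
Context {R : realType} {d N : nat}.
Implicit Types (X : 'M[R]_(d, N)) (Q : {set 'I_N}) (v u : 'cV[R]_d).

Lemma round_infoZ X Q (c : R) v :
  round_info X Q (c *: v) = c ^+ 2 * round_info X Q v.
Proof.
rewrite /round_info mulrA mulr_sumr; congr (_ / _).
by apply: eq_bigr => i _; rewrite utilityZ exprMn.
Qed.

Lemma round_info_le X Q v : (forall i, norm2 (col i X) <= 1) ->
  round_info X Q v <= norm2 v ^+ 2.
Proof.
move=> X1; have n0 := ler0n R #|Q|.
rewrite /round_info ler_pdivrMr; last by rewrite exprn_gt0//; lra.
apply: (@le_trans _ _ (\sum_(i in Q) norm2 v ^+ 2)).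
  apply: ler_sum => i _; rewrite -[_ ^+ 2]real_normK ?num_real//.
  by rewrite ler_sqr ?nnegrE ?norm2_ge0// utility_le.
rewrite sumr_const -[_ *+ _]mulr_natr ler_wpM2l ?sqr_ge0//.
by have := sqr_ge0 (#|Q|%:R : R); lra.
Qed.

(* The direction in which the rank-one matrix [g g^T] minorises the information
   matrix of the round while having the same value at [v]. *)
Definition info_direction X Q v : 'cV[R]_d :=
  (Num.sqrt (round_info X Q v))^-1 *:
    \sum_(i in Q) (utility X v i / (1 + #|Q|%:R) ^+ 2) *: col i X.

Lemma dot_info_direction X Q v u :
  dot (info_direction X Q v) u =
  (Num.sqrt (round_info X Q v))^-1 *
    ((\sum_(i in Q) utility X v i * utility X u i) / (1 + #|Q|%:R) ^+ 2).
Proof.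
rewrite /dot /info_direction linearZ /= -scalemxAl mxE; congr (_ * _).
rewrite linear_sum /= mulmx_suml summxE mulr_suml; apply: eq_bigr => i _.
rewrite linearZ /= -scalemxAl mxE.
have -> : ((col i X)^T *m u) 0 0 = utility X u i.
  by rewrite utilityE mxE; apply: eq_bigr => k _; rewrite !mxE.
ring.
Qed.

Lemma dot_info_direction_le X Q v u :
  dot (info_direction X Q v) u ^+ 2 <= round_info X Q u.
Proof.
rewrite dot_info_direction; set Iv := round_info X Q v.
(* A vanishing information makes the direction zero, since [0^-1 = 0]. *)
have [Iv0|Iv0] := eqVneq Iv 0.
  by rewrite Iv0 sqrtr0 invr0 mul0r expr0n round_info_ge0.
have Iv_gt0 : 0 < Iv by rewrite lt_neqAle eq_sym Iv0 round_info_ge0.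
rewrite exprMn exprVn sqr_sqrtr ?round_info_ge0// [leLHS]mulrC ler_pdivrMr//.
rewrite /Iv /round_info expr_div_n mulf_div -expr2.
have := ler0n R #|Q| => n0.
rewrite ler_wpM2r ?invr_ge0 ?sqr_ge0// mulrC.
exact: cauchy_schwarz_sum.
Qed.

Lemma dot_info_direction_self X Q v :
  dot (info_direction X Q v) v ^+ 2 = round_info X Q v.
Proof.
rewrite dot_info_direction.
have -> : (\sum_(i in Q) utility X v i * utility X v i) / (1 + #|Q|%:R) ^+ 2 =
    round_info X Q v by congr (_ / _); apply: eq_bigr => i _; rewrite expr2.
set Iv := round_info X Q v.
have [->|Iv0] := eqVneq Iv 0; first by rewrite mulr0 expr0n.
rewrite exprMn exprVn sqr_sqrtr ?round_info_ge0//.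
by field.
Qed.

(** The minorant tested on [g] itself gives [|g|^4 <= |g|^2]. *)
Lemma info_direction_le1 X Q v : (forall i, norm2 (col i X) <= 1) ->
  norm2 (info_direction X Q v) <= 1.
Proof.
move=> X1; set g := info_direction X Q v.
have : dot g g ^+ 2 <= norm2 g ^+ 2.
  exact: le_trans (dot_info_direction_le _ _ _ _) (round_info_le _ _ _ X1).
rewrite dot_norm2 => h; rewrite leNgt; apply/negP => g1.
have : 1 < norm2 g ^+ 2 by rewrite exprn_egt1.
by move: (norm2 g ^+ 2) h => x; nra.
Qed.

Lemma log_likE (lam : nat -> R) (X : nat -> 'M[R]_(d, N))
    (Q : nat -> {set 'I_N}) (r : nat -> 'I_N -> bool) t theta :
  log_lik lam X Q r t theta =
  \sum_(1 <= s < t) round_log_lik (X s) (Q s) (r s) theta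
  - lam t / 2 * norm2 theta ^+ 2.
Proof. by []. Qed.

Definition curvature (S : R) : R := expR (- (3 * S)) / (4 * (1 + S ^+ 2)).

Lemma curvature_gt0 S : 0 < curvature S.
Proof.
by rewrite divr_gt0 ?expR_gt0// mulr_gt0// ltr_pwDl// sqr_ge0.
Qed.

Lemma curvature_le1 S : 0 <= S -> curvature S <= 1.
Proof.
move=> S0; have S2 := sqr_ge0 S.
rewrite /curvature ler_pdivrMr ?mul1r; last by lra.
apply: (@le_trans _ _ 1); last by lra.
by rewrite expR_le1; lra.
Qed.

(** The penalty contributes [lam t * norm2 v ^+ 2] with constant 1, and [curvature S <= 1] lets it
    share the constant of the rounds. *)
Lemma log_lik_midpoint_le (lam : nat -> R) (X : nat -> 'M[R]_(d, N))
    (Q : nat -> {set 'I_N}) (r : nat -> 'I_N -> bool) t theta v (S : R) :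
  0 <= S -> 0 <= lam t ->
  (forall s i, (1 <= s < t)%N -> norm2 (col i (X s)) <= 1) ->
  norm2 theta <= S -> norm2 v <= S ->
  log_lik lam X Q r t (theta + v) + log_lik lam X Q r t (theta - v) <=
  2 * log_lik lam X Q r t theta
  - curvature S * (lam t * norm2 v ^+ 2
                   + \sum_(1 <= s < t) round_info (X s) (Q s) v).
Proof.
move=> S0 lam0 X1 thS vS; rewrite !log_likE.
have sums : \sum_(1 <= s < t) round_log_lik (X s) (Q s) (r s) (theta + v)
    + \sum_(1 <= s < t) round_log_lik (X s) (Q s) (r s) (theta - v) <=
    2 * (\sum_(1 <= s < t) round_log_lik (X s) (Q s) (r s) theta)
    - curvature S * \sum_(1 <= s < t) round_info (X s) (Q s) v.
  rewrite !mulr_sumr -big_split -sumrB /=.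
  rewrite big_nat_cond [X in _ <= X]big_nat_cond.
  apply: ler_sum => s /[!andbT] st.
  apply: round_log_lik_midpoint_le => // i _.
    exact: le_trans (utility_le _ _ _ (X1 _ _ st)) thS.
  exact: le_trans (utility_le _ _ _ (X1 _ _ st)) vS.
have par := norm2_parallelogram theta v.
have : curvature S * (lam t * norm2 v ^+ 2) <= lam t * norm2 v ^+ 2.
  by rewrite ler_piMl ?curvature_le1// mulr_ge0// sqr_ge0.
have : lam t / 2 * (norm2 (theta + v) ^+ 2 + norm2 (theta - v) ^+ 2) =
  lam t / 2 * (2 * norm2 theta ^+ 2 + 2 * norm2 v ^+ 2) by rewrite par.
rewrite mulrDr; lra.
Qed.

Lemma opt_assortment_card K X theta : (#|opt_assortment K X theta| <= K)%N.
Proof. by rewrite /opt_assortment; case: arg_maxP => //; rewrite cards0. Qed.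

Lemma regret_le (K T : nat) (Theta : set 'cV[R]_d) (S L : R) (lam : nat -> R)
    (delta : R) (X : nat -> 'M[R]_(d, N)) (Q : nat -> {set 'I_N})
    (r : nat -> 'I_N -> bool) (theta_hat theta_opt : nat -> 'cV[R]_d)
    (theta_star : 'cV[R]_d) (lam0 b : R) :
  0 <= S -> 0 < lam0 -> (forall t, (1 <= t <= T)%N -> lam t = lam0) ->
  (forall theta, Theta theta -> norm2 theta <= S) ->
  (forall t i, (1 <= t <= T)%N -> norm2 (col i (X t)) <= 1) ->
  cb_mnl_run K T Theta S L lam delta X Q r theta_hat theta_opt ->
  (forall t, (1 <= t <= T)%N ->
     conf_set K Theta S L lam delta X Q r (theta_hat t) t theta_star) ->
  (forall t, (1 <= t <= T)%N -> Defs.beta d K S L lam delta t ^+ 2 <= b) ->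
  regret K T theta_star X Q <=
  2 * expR (3 * S) * Num.sqrt (T%:R *
    (2 * b / curvature S * (1 + lam0^-1) * d%:R * ln (1 + T%:R / lam0))).
Proof.
move=> S0 lam_gt0 lamE ThetaS X1 run good betab.
pose v t : 'cV[R]_d := 2^-1 *: (theta_opt t - theta_star).
pose m t : 'cV[R]_d := 2^-1 *: (theta_opt t + theta_star).
have half (w : 'cV[R]_d) : 2^-1 *: w + 2^-1 *: w = w.
  by rewrite -scalerDl (_ : 2^-1 + 2^-1 = 1) ?scale1r//; field.
have mDv t : m t + v t = theta_opt t.
  by rewrite /m /v -scalerDr addrACA subrr addr0 scalerDr half.
have mBv t : m t - v t = theta_star.
  rewrite /m /v -scalerBr opprB addrC addrA subrK.
  by rewrite scalerDr half.
(* Coverage makes the confidence set nonempty, which activates the maximisation in [cb_mnl_run];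
   comparison with [theta_star] then gives optimism. *)
have optE t : (1 <= t <= T)%N ->
    conf_set K Theta S L lam delta X Q r (theta_hat t) t (theta_opt t) /\
    forall A : {set 'I_N}, (#|A| <= K)%N ->
      mu (X t) A theta_star <= mu (X t) (Q t) (theta_opt t).
  move=> tT; have [_ []] := run t tT; first by exists theta_star; exact: good.
  by move=> optin optmax; split=> // A AK; exact: optmax (good t tT).
have norms t : (1 <= t <= T)%N ->
    [/\ norm2 (theta_opt t) <= S, norm2 theta_star <= S, norm2 (m t) <= S &
        norm2 (v t) <= S].
  move=> tT; have [[/ThetaS oS _] _] := optE t tT.
  have [/ThetaS sS _] := good t tT.
  have := norm2_parallelogram (m t) (v t); rewrite mDv mBv => par.
  have o2 : norm2 (theta_opt t) ^+ 2 <= S ^+ 2.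
    by rewrite ler_sqr ?nnegrE ?norm2_ge0.
  have s2 : norm2 theta_star ^+ 2 <= S ^+ 2.
    by rewrite ler_sqr ?nnegrE ?norm2_ge0.
  have := sqr_ge0 (norm2 (m t)); have := sqr_ge0 (norm2 (v t)) => ? ?.
  by split=> //; rewrite -ler_sqr ?nnegrE ?norm2_ge0//; lra.
have c0 := curvature_gt0 S.
(* [theta_opt t] and [theta_star] are [m t + v t] and [m t - v t]. Both are within [b] of the
   maximal log-likelihood, which dominates the value at [m t], so the curvature term is at most
   [2 * b]. *)
have ellipsoid t : (1 <= t <= T)%N ->
    lam0 * norm2 (v t) ^+ 2 + \sum_(1 <= s < t) round_info (X s) (Q s) (v t)
      <= 2 * b / curvature S.
  move=> tT; have [_ _ mS vS] := norms t tT.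
  rewrite ler_pdivlMr// mulrC -(lamE t tT).
  have X1t s i : (1 <= s < t)%N -> norm2 (col i (X s)) <= 1.
    move=> /andP[s1 st]; apply: X1; rewrite s1 /=.
    by case/andP: tT => _; apply: leq_trans; exact: ltnW.
  have lt0 : 0 <= lam t by rewrite lamE// ltW.
  have := log_lik_midpoint_le _ _ Q r _ _ _ _ S0 lt0 X1t mS vS.
  rewrite mDv mBv.
  have [[_ h1] _] := optE t tT; have [_ h2] := good t tT.
  have [/(_ (m t)) h3 _] := run t tT; have := betab t tT; lra.
(* Rounds start at 1, indices of [g] at 0. Contexts are bounded up to the horizon only, hence the
   extension by zero. *)
pose g s := if (s < T)%N then info_direction (X s.+1) (Q s.+1) (v s.+1) else 0.
have g1 s : norm2 (g s) <= 1.
  rewrite /g; case: ifP => [sT|_]; last by rewrite norm20.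
  by apply: info_direction_le1 => i; exact: X1.
have gv s : (s < T)%N ->
    lam0 * norm2 (v s.+1) ^+ 2 + \sum_(j < s) dot (g j) (v s.+1) ^+ 2
      <= 2 * b / curvature S.
  move=> sT; apply: le_trans (ellipsoid s.+1 _); last by rewrite sT.
  rewrite lerD2l big_add1 /= big_mkord; apply: ler_sum => j _.
  by rewrite /g (ltn_trans (ltn_ord j) sT) dot_info_direction_le.
have pot := elliptical_potential _ _ g (fun s => v s.+1) T lam_gt0 g1 gv.
have infoE : \sum_(s < T) dot (g s) (v s.+1) ^+ 2 =
    \sum_(s < T) round_info (X s.+1) (Q s.+1) (v s.+1).
  by apply: eq_bigr => s _; rewrite /g ltn_ord dot_info_direction_self.
rewrite infoE in pot.
apply: (@le_trans _ _ (\sum_(s < T) 2 * expR (3 * S) *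
    Num.sqrt (round_info (X s.+1) (Q s.+1) (v s.+1)))).
  rewrite /regret big_add1 /= big_mkord; apply: ler_sum => s _.
  have sT : (1 <= s.+1 <= T)%N by rewrite ltn_ord.
  have [_ optmax] := optE _ sT; have [oS sS _ _] := norms _ sT.
  have := optmax _ (opt_assortment_card K (X s.+1) theta_star).
  have us w i : norm2 w <= S -> `|utility (X s.+1) w i| <= S.
    exact/le_trans/utility_le/X1.
  have := mu_sub_le (X s.+1) (Q s.+1) theta_star (theta_opt s.+1) S S0
            (fun i _ => us _ i sS) (fun i _ => us _ i oS).
  have -> : theta_opt s.+1 - theta_star = 2 *: v s.+1.
    by rewrite /v scalerA divff ?scale1r.
  rewrite round_infoZ sqrtrM ?sqr_ge0// sqrtr_sqr ger0_norm//; lra.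
rewrite -mulr_sumr ler_wpM2l ?mulr_ge0 ?expR_ge0//.
have sum0 : 0 <= \sum_(s < T) Num.sqrt (round_info (X s.+1) (Q s.+1) (v s.+1)).
  by apply: sumr_ge0 => s _; exact: sqrtr_ge0.
rewrite -[X in X <= _]ger0_norm// -sqrtr_sqr ler_sqrt; last first.
  rewrite mulr_ge0//; apply: le_trans pot.
  by apply: sumr_ge0 => s _; exact: round_info_ge0.
(* Cauchy-Schwarz against the constant 1 turns the sum of roots into the root of [T] times the
   potential. *)
have := cauchy_schwarz_sum predT (fun=> 1)
  (fun s : 'I_T => Num.sqrt (round_info (X s.+1) (Q s.+1) (v s.+1))).
under eq_bigr do rewrite mul1r.
move/le_trans; apply; rewrite expr1n sumr_const card_ord ler_wpM2l//.
under eq_bigr do rewrite sqr_sqrtr ?round_info_ge0//.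
exact: pot.
Qed.

End Regret.

(** * Discretised Gaussian mixtures *)

Section GaussianGrid.
Context {R : realType}.

Lemma expRN1_le : expR (- 1) <= 39 / 100 :> R.
Proof.
have : (9 / 8) ^+ 8 <= expR (8^-1) ^+ 8 :> R.
  rewrite ler_pXn2r ?nnegrE ?expR_ge0//.
  by apply: le_trans (expR_ge1Dx _); lra.
rewrite -expRM_natr mulVf//.
have : expR 1 * expR (- 1) = 1 :> R by rewrite -expRD subrr expR0.
have := expR_gt0 (- 1 : R); move: (expR 1) (expR (- 1)) => e e'; nra.
Qed.

Lemma expRN_half_ge : 586 / 1000 <= expR (- 2^-1) :> R.
Proof.
have : (7 / 8) ^+ 4 <= expR (- 8^-1) ^+ 4 :> R.
  rewrite ler_pXn2r ?nnegrE ?expR_ge0//.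
  by apply: le_trans (expR_ge1Dx _); lra.
rewrite -expRM_natr (_ : - 8^-1 * 4%:R = - 2^-1 :> R); last by field.
by apply: le_trans; lra.
Qed.

(** [x * expR (- x)] is largest at [x = 1]. *)
Lemma expRN_le_inv (x : R) : 0 < x -> expR (- x) <= 39 / 100 / x.
Proof.
move=> x0; rewrite ler_pdivlMr//; apply: le_trans expRN1_le.
have -> : expR (- 1) = expR (- x) * expR (x - 1) :> R.
  by rewrite -expRD; congr expR; ring.
by rewrite ler_wpM2l ?expR_ge0//; have := expR_ge1Dx (x - 1); lra.
Qed.

(** The first [n] terms are at most 1. From then on a term is at most [0.78 * n^2 / j^2 <= 0.78 *
    n^2 * (1 / (j - 1) - 1 / j)], which telescopes to at most [0.78 * n]; the induction carries the
    telescoped sum. *)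
Lemma half_gaussian_sum_le (n M : nat) : (0 < n)%N ->
  \sum_(1 <= j < M.+1) expR (- (j%:R ^+ 2 / (2 * n%:R ^+ 2))) <=
  178 / 100 * n%:R :> R.
Proof.
move=> n0; have nR : 0 < n%:R :> R by rewrite ltr0n.
pose f j : R := expR (- (j%:R ^+ 2 / (2 * n%:R ^+ 2))).
have small m : \sum_(1 <= j < m.+1) f j <= m%:R.
  elim: m => [|m IH]; first by rewrite big_nil.
  rewrite big_nat_recr//= -natr1 lerD// /f expR_le1 oppr_le0.
  by rewrite divr_ge0 ?sqr_ge0// mulr_ge0// sqr_ge0.
have f_ge0 j : 0 <= f j by exact: expR_ge0.
have [Mn|nM] := leqP M n.
  apply: le_trans (small M) _.
  have : M%:R <= n%:R :> R by rewrite ler_nat.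
  lra.
rewrite -(subnKC (ltnW nM)); move: (M - n)%N => q {nM}.
suff : \sum_(1 <= j < (n + q).+1) f j <=
    n%:R + 78 / 100 * (n%:R - n%:R ^+ 2 / (n + q)%:R).
  have : 0 <= n%:R ^+ 2 / (n + q)%:R :> R by rewrite divr_ge0 ?sqr_ge0 ?ler0n.
  rewrite /f; lra.
elim: q => [|q IH].
  rewrite addn0; apply: le_trans (small n) _.
  have -> : n%:R ^+ 2 / n%:R = n%:R :> R by field; rewrite gt_eqF.
  lra.
rewrite addnS big_nat_recr//=.
set k := (n + q)%N in IH *.
have k0 : 0 < k%:R :> R by rewrite ltr0n /k addn_gt0 n0.
have fk : f k.+1 <= 78 / 100 * (n%:R ^+ 2 / k%:R - n%:R ^+ 2 / k.+1%:R).
  have k10 : 0 < k.+1%:R :> R by rewrite ltr0n.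
  apply: (@le_trans _ _ (39 / 100 / (k.+1%:R ^+ 2 / (2 * n%:R ^+ 2)))).
    by apply: expRN_le_inv; rewrite divr_gt0 ?exprn_gt0// mulr_gt0// exprn_gt0.
  rewrite -natr1 in k10 *; rewrite -subr_ge0.
  have -> : 78 / 100 * (n%:R ^+ 2 / k%:R - n%:R ^+ 2 / (k%:R + 1)) -
     39 / 100 / ((k%:R + 1) ^+ 2 / (2 * n%:R ^+ 2)) =
     78 / 100 * n%:R ^+ 2 / (k%:R * (k%:R + 1) ^+ 2) :> R.
    by field; rewrite !gt_eqF.
  by apply: divr_ge0; apply: mulr_ge0; rewrite ?sqr_ge0 ?ltW//.
move: IH fk; move: (\sum_(1 <= j < k.+1) f j) (f k.+1) => a b.
move: (_ / k%:R) (_ / k.+1%:R) => c e; lra.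
Qed.

Lemma gaussian_sum_le (n M : nat) : (0 < n)%N ->
  \sum_(0 <= k < (M + M.+1)%N)
     expR (- ((k%:R - M%:R) ^+ 2 / (2 * n%:R ^+ 2))) <=
  1 + 356 / 100 * n%:R :> R.
Proof.
move=> n0; have := half_gaussian_sum_le n M n0.
pose f j : R := expR (- (j%:R ^+ 2 / (2 * n%:R ^+ 2))).
rewrite -/(f _) => half.
rewrite (@big_cat_nat _ _ _ M) ?leq_addr//=.
have -> : \sum_(0 <= k < M) expR (- ((k%:R - M%:R) ^+ 2 / (2 * n%:R ^+ 2))) =
    \sum_(1 <= j < M.+1) f j :> R.
  rewrite big_nat_rev /= add0n big_add1 /=.
  rewrite big_nat_cond [RHS]big_nat_cond; apply: eq_bigr => i /[!andbT] iM.
  by rewrite /f natrB// addrAC subrr add0r sqrrN.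
have -> : \sum_(M <= k < M + M.+1) expR (- ((k%:R - M%:R) ^+ 2 / (2 * n%:R ^+ 2))) =
    1 + \sum_(1 <= j < M.+1) f j :> R.
  rewrite -{1}[M]add0n big_addn addKn big_nat_recl//.
  rewrite add0n subrr expr0n /= mul0r oppr0 expR0 big_add1 /=.
  by congr (_ + _); apply: eq_bigr => i _; rewrite /f natrD addrK.
move: half; rewrite /f; lra.
Qed.

(** An interval of length [2 * r] contains [truncn (2 * r) > 2 * r - 1] consecutive integers;
    [r <= Y] and [Y + r < m] keep them in range. *)
Lemma count_near (M m : nat) (Y r : R) (f : nat -> R) (c : R) :
  0 <= c -> 1 <= r -> r <= Y -> Y + r < m%:R -> (forall k, 0 <= f k) ->
  (forall k, `|k%:R - Y| <= r -> c <= f k) ->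
  (2 * r - 1) * c <= \sum_(0 <= k < m) f k.
Proof.
move=> c0 r1 rY Ym f0 fc.
pose j0 := (Num.truncn (Y - r)).+1; pose q := Num.truncn (2 * r).
have Yr0 : 0 <= Y - r by lra.
have r20 : 0 <= 2 * r by lra.
have j0_gt : Y - r < j0%:R by exact: truncnS_gt.
have j0_le : j0%:R <= Y - r + 1 by rewrite -natr1 lerD2r truncn_le.
have q_gt : 2 * r < q%:R + 1 by rewrite natr1; exact: truncnS_gt.
have q_le : q%:R <= 2 * r by rewrite truncn_le.
have j0q : (j0 + q <= m)%N.
  by rewrite -ltnS -(ltr_nat R) -natr1 natrD; lra.
rewrite (@big_cat_nat _ _ _ j0) //=; last exact: leq_trans (leq_addr _ _) j0q.
rewrite (@big_cat_nat _ _ _ (j0 + q)%N _ m) ?leq_addr//=.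
have h1 : 0 <= \sum_(0 <= k < j0) f k by apply: sumr_ge0.
have h2 : 0 <= \sum_(j0 + q <= k < m) f k by apply: sumr_ge0.
have : q%:R * c <= \sum_(j0 <= k < j0 + q) f k.
  rewrite -[q in q%:R](addKn j0) mulr_natl -sumr_const_nat.
  rewrite big_nat_cond [X in _ <= X]big_nat_cond; apply: ler_sum => k /[!andbT].
  move=> /andP[jk kq]; apply: fc; rewrite ler_norml.
  have : j0%:R <= k%:R :> R by rewrite ler_nat.
  have : k%:R + 1 <= j0%:R + q%:R :> R by rewrite natr1 -natrD ler_nat.
  by move=> ? ?; apply/andP; split; lra.
have : (2 * r - 1) * c <= q%:R * c by rewrite ler_wpM2r//; lra.
lra.
Qed.

(* A common grid for all precisions [A] up to [Amax]: up to the factor 16/5, the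
   two sums compare as the Gaussian integrals they discretise. *)
Lemma gaussian_grid (lam Amax rho : R) : 0 < lam -> 0 <= rho ->
  exists (m : nat) (x : nat -> R), (0 < m)%N /\
  forall A y, lam <= A <= Amax -> `|y| <= rho ->
    \sum_(k < m) expR (- (lam / 2 * x k ^+ 2)) <=
    16 / 5 * Num.sqrt (A / lam) * \sum_(k < m) expR (- (A / 2 * (x k - y) ^+ 2)).
Proof.
move=> lam0 rho0.
(* The prior gets [n] grid points per standard deviation. The margins 10 and 8 are what the last
   step needs to compare [1 + 3.56 * n] with [1.8752 * (2 * n - s)] for every [s] up to
   [Num.sqrt (Amax / lam)]. *)
pose n := (Num.truncn (10 * Num.sqrt (Amax / lam))).+1.+4.+4.
have n_gt : 10 * Num.sqrt (Amax / lam) + 8 < n%:R.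
  have := truncnS_gt (10 * Num.sqrt (Amax / lam)).
  have -> : n%:R = (Num.truncn (10 * Num.sqrt (Amax / lam))).+1%:R + 8 :> R.
    by rewrite -natrD; congr _%:R; rewrite addnC.
  lra.
have nR : 0 < n%:R :> R by rewrite ltr0n.
have sl0 : 0 < Num.sqrt lam by rewrite sqrtr_gt0.
pose h := (n%:R * Num.sqrt lam)^-1.
have h0 : 0 < h by rewrite invr_gt0 mulr_gt0.
(* A centre [y] up to [rho] keeps a window of [n] grid steps on either side inside the grid. *)
pose M := (Num.truncn (rho / h + n%:R)).+1.
have M_gt : rho / h + n%:R < M%:R.
  exact: truncnS_gt.
exists (M + M.+1)%N, (fun k => h * (k%:R - M%:R)); split; first by rewrite addnS.
move=> A y /andP[lamA AAmax] yrho.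
have A0 : 0 < A by exact: lt_le_trans lam0 lamA.
set s := Num.sqrt (A / lam).
have s1 : 1 <= s.
  rewrite -sqrtr1 ler_sqrt; last by rewrite divr_ge0// ltW.
  by rewrite ler_pdivlMr ?mul1r.
have sle : s <= Num.sqrt (Amax / lam).
  rewrite ler_sqrt; last by rewrite divr_ge0// ltW// (lt_le_trans A0).
  by rewrite ler_pM2r ?invr_gt0.
rewrite /= -(big_mkord predT (fun k => expR (- (lam / 2 * (h * (k%:R - M%:R)) ^+ 2)))).
rewrite -(big_mkord predT (fun k => expR (- (A / 2 * (h * (k%:R - M%:R) - y) ^+ 2)))).
have Z_le : \sum_(0 <= k < M + M.+1) expR (- (lam / 2 * (h * (k%:R - M%:R)) ^+ 2))
    <= 1 + 356 / 100 * n%:R.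
  apply: le_trans (gaussian_sum_le n M isT).
  rewrite le_eqVlt; apply/orP; left; apply/eqP; apply: eq_bigr => k _.
  congr expR; congr (- _); rewrite exprMn /h exprVn exprMn sqr_sqrtr ?ltW//.
  by field; rewrite !gt_eqF.
have hs : n%:R / s = (h * Num.sqrt A)^-1.
  rewrite /s sqrtrM ?ltW// sqrtrV ?ltW// /h; field.
  by rewrite !gt_eqF// sqrtr_gt0.
have s_gt0 : 0 < s by exact: lt_le_trans ltr01 s1.
have nsn : n%:R / s <= n%:R.
  by rewrite ler_pdivrMr// ler_peMr// ltW.
have yh : `|y / h| <= rho / h.
  by rewrite normf_div (gtr0_norm h0) ler_pdivrMr// divfK// gt_eqF.
have := yh; rewrite ler_norml => /andP[yh1 yh2].
have ns1 : 1 <= n%:R / s.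
  by rewrite ler_pdivlMr // mul1r; lra.
(* [n / s] grid steps make one standard deviation for the precision [A], so the exponent there is at
   least [- 1 / 2]. *)
have near : forall k, `|k%:R - (y / h + M%:R)| <= n%:R / s ->
    expR (- 2^-1) <= expR (- (A / 2 * (h * (k%:R - M%:R) - y) ^+ 2)).
  move=> k kn; rewrite ler_expR lerN2.
  have -> : h * (k%:R - M%:R) - y = h * (k%:R - (y / h + M%:R)).
    by field; rewrite gt_eqF.
  have : (k%:R - (y / h + M%:R)) ^+ 2 <= (n%:R / s) ^+ 2.
    rewrite -[leLHS]real_normK ?num_real// ler_sqr ?nnegrE//.
    exact: le_trans kn.
  rewrite hs exprVn exprMn sqr_sqrtr ?(ltW A0)// => kk.
  rewrite exprMn mulrA.
  have Ah : 0 < A / 2 * h ^+ 2 by rewrite mulr_gt0 ?exprn_gt0// divr_gt0.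
  apply: le_trans (ler_wpM2l (ltW Ah) kk) _.
  rewrite le_eqVlt; apply/orP; left; apply/eqP.
  by field; rewrite !gt_eqF.
have mM : (M + M.+1)%N%:R = 2 * M%:R + 1 :> R by rewrite natrD -natr1; ring.
have G_ge := @count_near M (M + M.+1) (y / h + M%:R) (n%:R / s)
  (fun k => expR (- (A / 2 * (h * (k%:R - M%:R) - y) ^+ 2))) (expR (- 2^-1))
  (expR_ge0 _) ns1.
apply: le_trans Z_le _.
have {}G_ge := le_trans _ (G_ge _ _ (fun k => expR_ge0 _) near).
have G1 : (2 * (n%:R / s) - 1) * (586 / 1000) <=
  \sum_(0 <= k < M + M.+1) expR (- (A / 2 * (h * (k%:R - M%:R) - y) ^+ 2)).
  apply: G_ge.
  - by rewrite ler_wpM2l ?expRN_half_ge//; lra.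
  - lra.
  - by rewrite mM; lra.
apply: (@le_trans _ _ (16 / 5 * s * ((2 * (n%:R / s) - 1) * (586 / 1000)))).
  have -> : 16 / 5 * s * ((2 * (n%:R / s) - 1) * (586 / 1000)) =
     16 / 5 * (586 / 1000) * (2 * n%:R - s).
    by field; rewrite gt_eqF.
  lra.
by rewrite ler_wpM2l// mulr_ge0//; lra.
Qed.

End GaussianGrid.

Section GridMixture.
Context {R : realType} {d m : nat}.
Variables (lam : R) (x : nat -> R).

Definition grid_point (k : {ffun 'I_d -> 'I_m}) : 'cV[R]_d := \col_i x (k i).

Definition grid_mass : R := \sum_(j < m) expR (- (lam / 2 * x j ^+ 2)).

Definition grid_prior (k : {ffun 'I_d -> 'I_m}) : R :=
  \prod_(i < d) (expR (- (lam / 2 * x (k i) ^+ 2)) / grid_mass).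

Hypothesis m_gt0 : (0 < m)%N.

Lemma grid_mass_gt0 : 0 < grid_mass.
Proof.
rewrite /grid_mass (bigD1 (Ordinal m_gt0))//= ltr_pwDl ?expR_gt0//.
by apply: sumr_ge0 => j _; exact: expR_ge0.
Qed.

Lemma grid_prior_ge0 k : 0 <= grid_prior k.
Proof. by apply: prodr_ge0 => i _; rewrite divr_ge0 ?expR_ge0 ?ltW ?grid_mass_gt0. Qed.

Lemma grid_prior_sum1 : \sum_k grid_prior k = 1.
Proof.
rewrite -(bigA_distr_bigA (fun _ (j : 'I_m) => expR (- (lam / 2 * x j ^+ 2)) / grid_mass)).
rewrite big1// => i _; rewrite -mulr_suml divff// gt_eqF//.
exact: grid_mass_gt0.
Qed.

(** The unnormalised prior weight is the exponential of the penalty, so by the paraboloid bound each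
    summand is at least a multiple of a Gaussian of precision [A] centred at [th]. Its sum over the
    grid factorises by coordinates, and each coordinate costs one factor [C]. *)
Lemma grid_mixture_ge (l : 'cV[R]_d -> R) (th : 'cV[R]_d) (Fmax A C : R) :
  0 < C ->
  (forall u, Fmax - A / 2 * norm2 u ^+ 2 <=
             l (th + u) - lam / 2 * norm2 (th + u) ^+ 2) ->
  (forall i, grid_mass <= C * \sum_(j < m) expR (- (A / 2 * (x j - th i 0) ^+ 2))) ->
  expR Fmax / C ^+ d <= \sum_k grid_prior k * expR (l (grid_point k)).
Proof.
move=> C0 lF gridC; have Z0 := grid_mass_gt0.
have term (k : {ffun 'I_d -> 'I_m}) : expR Fmax / grid_mass ^+ d *
    \prod_(i < d) expR (- (A / 2 * (x (k i) - th i 0) ^+ 2)) <=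
    grid_prior k * expR (l (grid_point k)).
  rewrite /grid_prior prodf_div prodr_const card_ord -!expR_sum.
  rewrite mulrAC [leRHS]mulrAC ler_wpM2r ?invr_ge0 ?exprn_ge0 ?(ltW Z0)//.
  rewrite -!expRD ler_expR !sumrN -!mulr_sumr.
  have e : th + (grid_point k - th) = grid_point k by rewrite addrC subrK.
  have := lF (grid_point k - th); rewrite e !sqr_norm2.
  have -> : \sum_i (grid_point k - th) i 0 ^+ 2 = \sum_i (x (k i) - th i 0) ^+ 2.
    by apply: eq_bigr => i _; rewrite !mxE.
  have -> : \sum_i grid_point k i 0 ^+ 2 = \sum_i x (k i) ^+ 2.
    by apply: eq_bigr => i _; rewrite !mxE.
  lra.
apply: le_trans (ler_sum _ (fun k _ => term k)).
rewrite -mulr_sumr.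
rewrite -(bigA_distr_bigA (fun i (j : 'I_m) => expR (- (A / 2 * (x j - th i 0) ^+ 2)))).
have : \prod_(i < d) (grid_mass / C) <=
    \prod_(i < d) \sum_(j < m) expR (- (A / 2 * (x j - th i 0) ^+ 2)).
  apply: ler_prod => i _; rewrite divr_ge0 ?(ltW Z0) ?(ltW C0)//= ler_pdivrMr// mulrC.
  exact: gridC.
rewrite prodr_const card_ord => h.
have := ler_wpM2l (_ : 0 <= expR Fmax / grid_mass ^+ d) h.
move=> /(_ (divr_ge0 (expR_ge0 _) (exprn_ge0 _ (ltW Z0)))); apply: le_trans.
rewrite expr_div_n le_eqVlt; apply/orP; left; apply/eqP.
by field; rewrite !expf_neq0// gt_eqF.
Qed.

End GridMixture.

(** * The confidence radius *)

Section Radius.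
Context {R : realType}.

Lemma ln2_ge_half : 1 / 2 <= ln 2 :> R.
Proof.
have : expR (1 / 2) <= 2 :> R.
  have := expR_ge1Dx (- (1 / 2) : R); rewrite expRN => h.
  rewrite -[leLHS]invrK -[leRHS]invrK lef_pV2 ?posrE ?invr_gt0 ?expR_gt0//.
  by apply: le_trans h; lra.
by rewrite -ler_ln ?posrE ?expR_gt0// expRK.
Qed.

Lemma ln_1D2n_le (m : nat) : (2 <= m)%N -> ln (1 + 2 * m%:R) <= 3 * ln m%:R :> R.
Proof.
move=> m2; have mR : 2 <= m%:R :> R by rewrite ler_nat.
rewrite (_ : 3 * _ = ln (m%:R ^+ 3)); last first.
  by rewrite lnXn ?mulr_natl//; lra.
by rewrite ler_ln ?posrE ?exprn_gt0//; nra.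
Qed.

Lemma ln_nat_ge_half (m : nat) : (2 <= m)%N -> 1 / 2 <= ln m%:R :> R.
Proof.
move=> m2; apply: le_trans ln2_ge_half _.
by rewrite ler_ln ?posrE ?ltr0n ?ler_nat// (leq_trans _ m2).
Qed.

Section Fixed.
Variables (d K T t : nat) (S L delta : R) (lam : nat -> R).
Hypotheses (d_gt0 : (0 < d)%N) (KT2 : (2 <= K * T)%N) (tT : (1 <= t <= T)%N)
  (lamE : lam t = d%:R * ln (K * T)%:R) (delta01 : 0 < delta <= 1)
  (S_ge0 : 0 <= S) (L_ge : 1 / 4 <= L).

Let w : R := L * K%:R * t%:R / (d%:R * lam t).
Let B : R := d%:R / 2 * ln (1 + w) - ln delta + d%:R * ln 2.

Let dR : 1 <= d%:R :> R. Proof. by rewrite ler1n. Qed.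
Let l_ge : 1 / 2 <= ln (K * T)%:R :> R. Proof. exact: ln_nat_ge_half. Qed.
Let lam_ge : 1 / 2 <= lam t. Proof. by rewrite lamE; move: dR l_ge; nra. Qed.
Let lam_gt0 : 0 < lam t. Proof. by move: lam_ge; lra. Qed.
Let sl_gt0 : 0 < Num.sqrt (lam t). Proof. by rewrite sqrtr_gt0. Qed.
Let sl_sqr : Num.sqrt (lam t) ^+ 2 = lam t. Proof. by rewrite sqr_sqrtr// ltW. Qed.
Let K_ge1 : 1 <= K%:R :> R.
Proof. by rewrite ler1n; move: KT2; case: K. Qed.
Let t_le : t%:R <= (K * T)%:R :> R.
Proof.
case/andP: tT => _ h; rewrite ler_nat (leq_trans h)// leq_pmull//.
by move: KT2; case: K.
Qed.
Let lndelta : ln delta <= 0. Proof. by case/andP: delta01 => _; exact: ln_le0. Qed.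
Let w_ge0 : 0 <= w.
Proof.
have L0 : 0 <= L by move: L_ge; lra.
by apply: divr_ge0; rewrite !mulr_ge0 ?(ltW lam_gt0).
Qed.

Let B_ge0 : 0 <= B.
Proof.
have h1 : 0 <= d%:R / 2 * ln (1 + w).
  by rewrite mulr_ge0 ?divr_ge0// ln_ge0// lerDl.
have h2 : 0 <= d%:R * ln 2 :> R by rewrite mulr_ge0// ln_ge0// ler1n.
by rewrite /B; move: lndelta h1 h2; lra.
Qed.

Lemma gammaE : Defs.gamma d K S L lam delta t =
  Num.sqrt (lam t) * (S + 1 / 2) + 2 / Num.sqrt (lam t) * B.
Proof.
have d0 : 0 < d%:R :> R by rewrite ltr0n.
have delta0 : 0 < delta by case/andP: delta01.
have wE : lam t + L * K%:R * t%:R / d%:R = lam t * (1 + w).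
  by rewrite /w; field; rewrite !gt_eqF.
have w1 : 0 < 1 + w by move: w_ge0; lra.
rewrite /Defs.gamma wE ln_div ?posrE//; last first.
  by rewrite mulr_gt0// powR_gt0// mulr_gt0.
rewrite lnM ?posrE ?powR_gt0 ?mulr_gt0// !ln_powR lnM ?posrE//.
by rewrite /B; field; rewrite gt_eqF.
Qed.

Let gamma_ge0 : 0 <= Defs.gamma d K S L lam delta t.
Proof.
rewrite gammaE addr_ge0// mulr_ge0 ?divr_ge0 ?(ltW sl_gt0)//.
by move: S_ge0; lra.
Qed.

(** The left side is the cost of the mixture argument: [1 / delta] from Ville, one factor per
    coordinate from the grid, and the penalty at [theta_star]. In [gamma ^ 2], the part
    [Num.sqrt (lam t) / 2] contributes its square [lam t / 4], and its cross term with
    [2 / Num.sqrt (lam t) * B] contributes [2 * B]. *)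
Lemma beta_sqr_ge :
  - ln delta + d%:R * ln (16 / 5 * Num.sqrt ((lam t + t%:R) / lam t))
  + lam t / 2 * S ^+ 2 <= Defs.beta d K S L lam delta t ^+ 2.
Proof.
have beta_ge : Defs.gamma d K S L lam delta t <= Defs.beta d K S L lam delta t.
  by rewrite /Defs.beta lerDl divr_ge0 ?sqr_ge0// ltW.
apply: (@le_trans _ _ (Defs.gamma d K S L lam delta t ^+ 2)); last first.
  by rewrite ler_sqr ?nnegrE// (le_trans gamma_ge0).
have gamma_sqr : lam t * S ^+ 2 + lam t / 4 + 2 * B <=
    Defs.gamma d K S L lam delta t ^+ 2.
  rewrite gammaE sqrrD exprMn sl_sqr.
  have -> : Num.sqrt (lam t) * (S + 1 / 2) * (2 / Num.sqrt (lam t) * B) =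
    2 * (S + 1 / 2) * B by field; rewrite gt_eqF.
  have := sqr_ge0 (2 / Num.sqrt (lam t) * B).
  have := mulr_ge0 S_ge0 B_ge0.
  have : 0 <= lam t * S by rewrite mulr_ge0// ltW.
  move: B_ge0; lra.
apply: le_trans gamma_sqr.
suff key : ln (16 / 5 * Num.sqrt ((lam t + t%:R) / lam t)) <=
    ln (K * T)%:R / 4 + ln (1 + w) + 2 * ln 2.
  have := ler_wpM2l (le_trans ler01 dR) key.
  have : 0 <= lam t / 2 * S ^+ 2 by rewrite mulr_ge0 ?sqr_ge0// divr_ge0// ltW.
  rewrite /B lamE; move: lndelta; lra.
have lg := l_ge; have tle := t_le.
set m : R := (K * T)%:R in lg tle *.
have lamE' : lam t = d%:R * ln m by exact: lamE.
have m_ge : 2 <= m by rewrite /m ler_nat.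
clearbody m; have m_gt0 : 0 < m by lra.
set u := t%:R / lam t.
have u0 : 0 <= u by rewrite divr_ge0// ltW.
have -> : (lam t + t%:R) / lam t = 1 + u by rewrite /u; field; rewrite gt_eqF.
(* [w] has an extra [d] in its denominator compared with [u]. As [lam t = d * ln m] and [t <= m], a
   second factor [u], divided by [m], makes up for it; [1 / 4 <= L] and [1 / 2 <= ln m] give the
   8. *)
have w_ge : u ^+ 2 / (8 * m) <= w.
  have d0 : 0 < d%:R :> R by rewrite ltr0n.
  have -> : u ^+ 2 / (8 * m) = t%:R / (d%:R * lam t) * (t%:R / (8 * m * ln m)).
    have l0 : 0 < ln m by move: lg; lra.
    rewrite /u lamE'; field.
    by rewrite !gt_eqF.
  have -> : w = t%:R / (d%:R * lam t) * (L * K%:R).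
    by rewrite /w; field; rewrite !gt_eqF.
  rewrite ler_wpM2l//; first by rewrite divr_ge0// mulr_ge0// ltW.
  apply: (@le_trans _ _ (1 / 4)); last by move: L_ge K_ge1; nra.
  rewrite ler_pdivrMr; last by rewrite !mulr_gt0//; move: lg; lra.
  by move: tle lg m_ge; nra.
set y := Num.sqrt m.
have y_sqr : y ^+ 2 = m by rewrite sqr_sqrtr//; move: m_ge; lra.
have y_ge : 141 / 100 <= y.
  by rewrite -ler_sqr ?nnegrE ?sqrtr_ge0 ?y_sqr; move: m_ge; lra.
(* The slack [lam / 4] of [gamma ^ 2] contributes [y = sqrt (K * T)] here; it pays
   for [d] large, while [w] pays for [u] large. *)
have poly : (16 / 5) ^+ 2 * (1 + u) <= 16 * y * (1 + w) ^+ 2.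
  have y0 : 0 < y by move: y_ge; lra.
  set x := u / y.
  have ux : u = x * y by rewrite /x divfK// gt_eqF.
  have wx : x ^+ 2 / 8 <= w.
    apply: le_trans w_ge; rewrite -y_sqr ux le_eqVlt; apply/orP; left.
    by apply/eqP; field; rewrite gt_eqF.
  have w2 : 1 + x ^+ 2 / 4 <= (1 + w) ^+ 2 by move: w_ge0 wx; nra.
  have h : 16 * y * (1 + x ^+ 2 / 4) <= 16 * y * (1 + w) ^+ 2.
    by rewrite ler_wpM2l// mulr_ge0// ltW.
  apply: le_trans h; rewrite ux.
  (* The quadratic is minimal at [x = 1.28], with value above 9, and [(16 / 5) ^+ 2 <= 9 * y]. *)
  have q : 9 <= 16 + 4 * x ^+ 2 - (16 / 5) ^+ 2 * x.
    by have := sqr_ge0 (x - 128 / 100); lra.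
  have := ler_wpM2l (ltW y0) q; move: y_ge; lra.
have u1 : 0 < 1 + u by move: u0; lra.
have w1 : 0 < 1 + w by move: w_ge0; lra.
have y0 : 0 < y by move: y_ge; lra.
have c0 : 0 < 16 / 5 :> R by lra.
have y16 : 0 < 16 * y by rewrite mulr_gt0.
have := poly; rewrite -ler_ln ?posrE ?mulr_gt0 ?exprn_gt0//.
have -> : ln ((16 / 5) ^+ 2 * (1 + u)) = 2 * ln (16 / 5) + ln (1 + u).
  by rewrite lnM ?posrE ?exprn_gt0// lnXn//; ring.
have -> : ln (16 * y * (1 + w) ^+ 2) = 4 * ln 2 + ln m / 2 + 2 * ln (1 + w).
  rewrite lnM ?posrE ?exprn_gt0// lnM ?posrE// lnXn// (_ : 16 = 2 ^+ 4) -?natrX//.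
  by rewrite natrX lnXn// /y -powR12_sqrt ?ltW// ln_powR; ring.
have -> : ln (16 / 5 * Num.sqrt (1 + u)) = ln (16 / 5) + ln (1 + u) / 2.
  by rewrite lnM ?posrE ?sqrtr_gt0// -powR12_sqrt ?ltW// ln_powR; field.
lra.
Qed.

Definition radius_const : R := S + 11 / 2 - 4 * ln delta.

Hypothesis L_le1 : L <= 1.

(** [w] is at most linear in [K * T], so its logarithm is at most a multiple of [ln (K * T)] and
    [gamma] is of order [Num.sqrt (lam t)]. The lower bound on [lam t] absorbs [- ln delta] and lets
    the bounded term [gamma ^ 2 / lam t] be charged to [Num.sqrt (lam t)]. *)
Lemma beta_sqr_le :
  Defs.beta d K S L lam delta t ^+ 2 <=
  lam t * (radius_const + 2 * radius_const ^+ 2) ^+ 2.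
Proof.
set G := radius_const.
have G_ge0 : 0 <= G by rewrite /G /radius_const; move: S_ge0 lndelta; lra.
have B_le : B <= lam t * (5 / 2 - 2 * ln delta).
  have w_le : w <= 2 * (K * T)%:R.
    rewrite /w ler_pdivrMr; last by rewrite mulr_gt0// ltr0n.
    have : L * K%:R * t%:R <= (K * T)%:R.
      rewrite natrM -mulrA; apply: (@le_trans _ _ (K%:R * t%:R)).
        by rewrite ler_piMl// mulr_ge0.
      by rewrite ler_wpM2l// ler_nat; case/andP: tT.
    have : 1 / 2 <= d%:R * lam t by move: dR lam_ge; nra.
    have := ler0n R (K * T); nra.
  have : ln (1 + w) <= 3 * ln (K * T)%:R.
    apply: le_trans (ln_1D2n_le _ KT2).
    by rewrite ler_ln ?posrE ?lerD2l//; move: w_ge0 w_le; lra.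
  have l2 : ln 2 <= ln (K * T)%:R :> R.
    by rewrite ler_ln ?posrE ?ler_nat// ltr0n (leq_trans _ KT2).
  move=> lw; have d0 : 0 <= d%:R :> R by [].
  have := ler_wpM2l d0 lw; have := ler_wpM2l d0 l2.
  have : - ln delta <= lam t * (- 2 * ln delta) by move: lam_ge lndelta; nra.
  rewrite /B !lamE; lra.
have gamma_le : Defs.gamma d K S L lam delta t <= Num.sqrt (lam t) * G.
  rewrite gammaE.
  have : 2 / Num.sqrt (lam t) * B <= 2 / Num.sqrt (lam t) * (lam t * (5 / 2 - 2 * ln delta)).
    by rewrite ler_wpM2l// divr_ge0// ltW.
  have -> : 2 / Num.sqrt (lam t) * (lam t * (5 / 2 - 2 * ln delta)) =
      Num.sqrt (lam t) * (5 - 4 * ln delta).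
    by rewrite -[X in _ * (X * _)]sl_sqr; field; rewrite gt_eqF.
  rewrite /G /radius_const; lra.
have sl_ge : 1 / 2 <= Num.sqrt (lam t).
  by rewrite -ler_sqr ?nnegrE ?(ltW sl_gt0)// sl_sqr; move: lam_ge; lra.
have gamma_sqr : Defs.gamma d K S L lam delta t ^+ 2 / lam t <= G ^+ 2.
  rewrite ler_pdivrMr// mulrC -[X in _ <= X * _]sl_sqr -exprMn.
  by rewrite ler_sqr ?nnegrE ?mulr_ge0 ?(ltW sl_gt0).
have beta_ge0 : 0 <= Defs.beta d K S L lam delta t.
  by rewrite addr_ge0// divr_ge0 ?sqr_ge0// ltW.
rewrite -[X in _ <= X * _]sl_sqr -exprMn ler_sqr ?nnegrE//; last first.
  by rewrite mulr_ge0 ?(ltW sl_gt0)// addr_ge0// mulr_ge0// sqr_ge0.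
rewrite /Defs.beta mulrDr lerD//; apply: le_trans gamma_sqr _.
have := sqr_ge0 G; move: (G ^+ 2) sl_ge => q; nra.
Qed.

End Fixed.
End Radius.

(** * A lower bound on [L] *)

Lemma is_derive_logistic0 {R : realType} :
  is_derive (0 : R) (1 : R) (fun h => expR h / (1 + expR h)) (1 / 4).
Proof.
have den h : 1 + expR h != 0 :> R by rewrite gt_eqF// ltr_pwDl// expR_ge0.
have dd : is_derive (0 : R) (1 : R) (fun h => 1 + expR h) 1.
  apply: is_derive_eq; by rewrite add0r expR0 mulr1.
have dV := @is_deriveV R (fun h => 1 + expR h) 0 1 1 (den 0) dd.
apply: (is_derive_eq (is_deriveM _ dV)).
by rewrite /GRing.scale /= expR0; field.
Qed.

(** With one item at utility 0 the softmax is the logistic function where it is steepest, with slope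
    1/4. Coverage needs [L] from below because [L] multiplies the growth term of [gamma]. *)
Lemma softmax_derive_bound_ge {R : realType} {N K : nat} (L : R) (i : 'I_N) :
  (0 < K)%N ->
  (forall (A : {set 'I_N}) i j (z : 'cV[R]_N),
    (#|A| <= K)%N -> i \in A -> j \in A ->
    'D_(delta_mx j 0) (softmax A i : 'cV[R]_N -> R^o) z <= L) ->
  1 / 4 <= L.
Proof.
move=> K0 /(_ (finset.set1 i) i i 0); rewrite cards1 inE eqxx => /(_ K0 isT isT).
apply: le_trans; rewrite le_eqVlt; apply/orP; left; apply/eqP; apply/esym.
pose f (h : R) : R := expR h / (1 + expR h).
have -> : 1 / 4 = derive1 f 0.
  by rewrite derive1E; case: (@is_derive_logistic0 R) => _ ->.
rewrite /derive1 /derive; set q := (fun h : R => _); set q' := (fun h : R => _).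
suff -> : q = q' by [].
apply/funext => h; rewrite /q /q'; congr (_ *: (_ - _)).
- by rewrite /= /softmax big_set1 /f !mxE !eqxx mulr1 !addr0.
- by rewrite /softmax big_set1 /f !mxE.
Qed.

(** * Conditional expectations of bounded functions *)

Section BoundedMeasurable.
Context {R : realType} {disp : measure_display} {T : measurableType disp}.
Implicit Types (f g : T -> R) (A : set T).

(** Taking [g_sigma_algebraType G] for [T], over the same points, expresses measurability with
    respect to a sub-sigma-algebra. Boundedness gives integrability and survives products. *)
Definition bounded_measurable f : Prop :=
  measurable_fun setT f /\ exists b : R, forall x, `|f x| <= b.

Lemma bounded_measurable_eq f g :
  (forall x, f x = g x) -> bounded_measurable g -> bounded_measurable f.
Proof. by move=> /funext ->. Qed.

Lemma bounded_measurable_cst c : bounded_measurable (fun=> c).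
Proof. by split; [exact: measurable_cst|exists `|c|]. Qed.

Lemma bounded_measurableD f g : bounded_measurable f -> bounded_measurable g ->
  bounded_measurable (fun x => f x + g x).
Proof.
move=> [mf [a fa]] [mg [b gb]]; split; first exact: measurable_funD.
by exists (a + b) => x; rewrite (le_trans (ler_normD _ _))// lerD.
Qed.

Lemma bounded_measurableM f g : bounded_measurable f -> bounded_measurable g ->
  bounded_measurable (fun x => f x * g x).
Proof.
move=> [mf [a fa]] [mg [b gb]]; split; first exact: measurable_funM.
by exists (a * b) => x; rewrite normrM ler_pM.
Qed.

Lemma bounded_measurableB f g : bounded_measurable f -> bounded_measurable g ->
  bounded_measurable (fun x => f x - g x).
Proof.
move=> [mf [a fa]] [mg [b gb]]; split; first exact: measurable_funB.
by exists (a + b) => x; rewrite (le_trans (ler_normB _ _))// lerD.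
Qed.

Lemma bounded_measurable_sum (I : Type) (s : seq I) (p : pred I)
    (f : I -> T -> R) : (forall i, p i -> bounded_measurable (f i)) ->
  bounded_measurable (fun x => \sum_(i <- s | p i) f i x).
Proof.
move=> bf; elim: s => [|i s IH].
  apply: (bounded_measurable_eq _ (fun=> 0)) => [x|].
    by rewrite big_nil.
  exact: bounded_measurable_cst.
apply: (bounded_measurable_eq _ (fun x =>
    (if p i then f i x else 0) + \sum_(j <- s | p j) f j x)) => [x|].
  by rewrite big_cons; case: ifP => // _; rewrite add0r.
apply: bounded_measurableD => //; case pi: (p i); first exact: bf.
exact: bounded_measurable_cst.
Qed.

Lemma bounded_measurable_prod (I : Type) (s : seq I) (p : pred I)
    (f : I -> T -> R) : (forall i, p i -> bounded_measurable (f i)) ->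
  bounded_measurable (fun x => \prod_(i <- s | p i) f i x).
Proof.
move=> bf; elim: s => [|i s IH].
  apply: (bounded_measurable_eq _ (fun=> 1)) => [x|].
    by rewrite big_nil.
  exact: bounded_measurable_cst.
apply: (bounded_measurable_eq _ (fun x =>
    (if p i then f i x else 1) * \prod_(j <- s | p j) f j x)) => [x|].
  by rewrite big_cons; case: ifP => // _; rewrite mul1r.
apply: bounded_measurableM => //; case pi: (p i); first exact: bf.
exact: bounded_measurable_cst.
Qed.

Lemma bounded_measurable_bool (b : T -> bool) : measurable [set x | b x] ->
  bounded_measurable (fun x => (b x)%:R).
Proof.
move=> mb; split; last by exists 1 => x; rewrite normr_nat; case: (b x).
rewrite (_ : (fun _ => _) = \1_[set x | b x]); first exact: measurable_indic.
by apply/funext => x; rewrite indicE mem_setE.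
Qed.

Lemma bounded_measurable_expR f : bounded_measurable f ->
  bounded_measurable (fun x => expR (f x)).
Proof.
move=> [mf [b fb]]; split; first exact: measurableT_comp.
exists (expR b) => x; rewrite ger0_norm ?expR_ge0// ler_expR.
exact: le_trans (ler_norm _) (fb x).
Qed.

Lemma bounded_measurableV f : (forall x, 1 <= f x) -> measurable_fun setT f ->
  bounded_measurable (fun x => (f x)^-1).
Proof.
move=> f1 mf; have f0 x : 0 < f x by exact: lt_le_trans (f1 x).
split; last first.
  exists 1 => x; rewrite ger0_norm ?invr_ge0 ?(ltW (f0 x))//.
  by rewrite invf_le1.
rewrite (_ : (fun _ => _) = fun x => expR (- ln (f x))); last first.
  by apply/funext => x; rewrite expRN lnK ?posrE.
apply: measurableT_comp => //; apply: measurableT_comp => //.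
by apply: measurableT_comp => //; exact: measurable_ln.
Qed.

(** For quantities read off the random assortment: on each event [q x = i] the index is frozen. *)
Lemma bounded_measurable_select {I : finType} (q : T -> I) (f : I -> T -> R) :
  (forall i, measurable [set x | q x = i]) ->
  (forall i, bounded_measurable (f i)) ->
  bounded_measurable (fun x => f (q x) x).
Proof.
move=> mq bf; apply: (bounded_measurable_eq _
    (fun x => \sum_i (q x == i)%:R * f i x)) => [x|].
  rewrite (bigD1 (q x))//= eqxx mul1r big1 ?addr0// => i iq.
  by rewrite eq_sym (negbTE iq) mul0r.
apply: bounded_measurable_sum => i _; apply: bounded_measurableM => //.
apply: bounded_measurable_bool; rewrite (_ : [set x | _] = [set x | q x = i])//.
by apply/seteqP; split=> x /= /eqP.
Qed.

End BoundedMeasurable.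

Section Expectation.
Context {R : realType} {disp : measure_display} {Omega : measurableType disp}.
Variable P : probability Omega R.
Implicit Types f g : Omega -> R.

Definition mean f : R := \int[P]_w f w.

Lemma bounded_measurable_integrable f : bounded_measurable f ->
  P.-integrable setT (EFin \o f).
Proof.
move=> [mf [b fb]]; apply: measurable_bounded_integrable => //.
  have PT : P setT = 1%E by exact: probability_setT.
  by have : (P setT < +oo)%E by rewrite PT ltry.
exists b; split; first exact: num_real.
by move=> x bx w _; exact: le_trans (fb w) (ltW bx).
Qed.

Lemma eq_mean f g : (forall w, f w = g w) -> mean f = mean g.
Proof. by move=> /funext ->. Qed.

Lemma mean_cst c : mean (fun=> c) = c.
Proof.
transitivity (c * fine (P setT)); first exact: Rintegral_cst.
have -> : P setT = 1%E by exact: probability_setT.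
by rewrite mulr1.
Qed.

Lemma meanD f g : bounded_measurable f -> bounded_measurable g ->
  mean (fun w => f w + g w) = mean f + mean g.
Proof. by move=> bf bg; rewrite /mean RintegralD//; exact: bounded_measurable_integrable. Qed.

Lemma meanB f g : bounded_measurable f -> bounded_measurable g ->
  mean (fun w => f w - g w) = mean f - mean g.
Proof. by move=> bf bg; rewrite /mean RintegralB//; exact: bounded_measurable_integrable. Qed.

Lemma meanZ c f : bounded_measurable f -> mean (fun w => c * f w) = c * mean f.
Proof. by move=> bf; rewrite /mean RintegralZl//; exact: bounded_measurable_integrable. Qed.

Lemma le_mean f g : bounded_measurable f -> bounded_measurable g ->
  (forall w, f w <= g w) -> mean f <= mean g.
Proof.
by move=> bf bg fg; apply: le_Rintegral => //; exact: bounded_measurable_integrable.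
Qed.

Lemma mean_sum (I : Type) (s : seq I) (f : I -> Omega -> R) :
  (forall i, bounded_measurable (f i)) ->
  mean (fun w => \sum_(i <- s) f i w) = \sum_(i <- s) mean (f i).
Proof.
move=> bf; elim: s => [|i s IH].
  by rewrite big_nil -[RHS](mean_cst 0); apply: eq_mean => w; rewrite big_nil.
rewrite big_cons -IH -meanD//; last exact: bounded_measurable_sum.
by apply: eq_mean => w; rewrite big_cons.
Qed.

Lemma mean_bool (b : Omega -> bool) : measurable [set w | b w] ->
  (mean (fun w => (b w)%:R))%:E = P [set w | b w].
Proof.
move=> mb; rewrite /mean /Rintegral fineK; last first.
  exact: integrable_fin_num (bounded_measurable_integrable _ (bounded_measurable_bool _ mb)).
transitivity (\int[P]_w (\1_[set w | b w] w)%:E)%E; last first.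
  by rewrite integral_indic// setIT.
by apply: eq_integral => w _; rewrite indicE mem_setE.
Qed.

(** The count is the integer part of [x]. *)
Lemma threshold_count (m : nat) (x : R) : 0 <= x <= m%:R ->
  \sum_(j < m) (j.+1%:R <= x)%R%:R <= x <= \sum_(j < m) (j.+1%:R <= x)%R%:R + 1.
Proof.
move=> /andP[x0 xm]; pose k := Num.truncn x.
have kx : k%:R <= x by rewrite truncn_le.
have xk : x < k%:R + 1 by rewrite natr1; exact: truncnS_gt.
have km : (k <= m)%N.
  by rewrite -(ler_nat R); exact: le_trans kx xm.
have -> : \sum_(j < m) (j.+1%:R <= x)%R%:R = k%:R :> R.
  have -> : \sum_(j < m) (j.+1%:R <= x)%R%:R = \sum_(j < m | (j < k)%N) 1 :> R.
    rewrite [RHS]big_mkcond; apply: eq_bigr => j _.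
    have -> : (j.+1%:R <= x) = (j < k)%N; last by case: ifP.
    apply/idP/idP => [jx|jk].
      rewrite -ltnS -(ltr_nat R); apply: le_lt_trans jx _; by rewrite -natr1.
    by apply: le_trans kx; rewrite ler_nat.
  by rewrite -(big_ord_widen m (fun=> 1) km) sumr_const card_ord.
by rewrite kx ltW.
Qed.

Section SubSigmaAlgebra.
Variable G : set (set Omega).
Hypothesis G_measurable : <<s G >> `<=` measurable.

Lemma bounded_measurable_sub f :
  bounded_measurable (f : g_sigma_algebraType G -> R) -> bounded_measurable f.
Proof.
move=> [mf bf]; split=> // mT B mB.
by apply: G_measurable; exact: (mf measurableT).
Qed.

(** [is_cond_prob] tests events only. Linearity reaches step functions, and since both weights lie
    in [0, 1], a uniform error [e] on [Z] costs at most [e] in each mean. *)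
Lemma mean_cond_prob (E : Omega -> bool) (p : Omega -> R) (Z : Omega -> R) :
  measurable [set w | E w] ->
  is_cond_prob P <<s G >> [set w | E w] p ->
  (forall w, 0 <= p w <= 1) ->
  bounded_measurable (Z : g_sigma_algebraType G -> R) ->
  mean (fun w => Z w * (E w)%:R) = mean (fun w => Z w * p w).
Proof.
move=> mE [mp pE] p01 GZ.
have bE := bounded_measurable_bool (R := R) _ mE.
have Gp : bounded_measurable (p : g_sigma_algebraType G -> R).
  split; first by move=> _ B mB; rewrite setTI; exact: mp.
  by exists 1 => w; have /andP[? ?] := p01 w; rewrite ger0_norm.
have bp := bounded_measurable_sub p Gp.
have indE (A : Omega -> bool) : <<s G >> [set w | A w] ->
    mean (fun w => (A w)%:R * (E w)%:R) = mean (fun w => (A w)%:R * p w).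
  move=> GA; have mA := G_measurable _ GA.
  apply: EFin_inj.
  have -> : (mean (fun w => (A w)%:R * (E w)%:R))%:E =
      P ([set w | A w] `&` [set w | E w]).
    rewrite (_ : _ `&` _ = [set w | A w && E w]); last first.
      by apply/seteqP; split=> w /= /andP.
    rewrite -mean_bool; first by congr _%:E; apply: eq_mean => w;
      case: (A w); rewrite ?mul1r ?mul0r.
    rewrite (_ : [set w | _] = [set w | A w] `&` [set w | E w]).
      exact: measurableI.
    by apply/seteqP; split=> w /= /andP.
  rewrite pE// integral_mkcond /mean /Rintegral fineK; last first.
    apply: integrable_fin_num => //; apply: bounded_measurable_integrable.
    by apply: bounded_measurableM => //; exact: bounded_measurable_bool.
  apply: eq_integral => w _; rewrite patchE; case: ifPn => [|/negP].
    by rewrite inE /= => ->; rewrite mul1r.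
  by rewrite inE /= => /negP/negbTE ->; rewrite mul0r.
have [_ [b Zb]] := GZ; have bZ := bounded_measurable_sub Z GZ.
have b0 : 0 <= b by have := Zb point; apply: le_trans.
have step n (e := n.+1%:R^-1 : R) :
    `|mean (fun w => Z w * (E w)%:R) - mean (fun w => Z w * p w)| <= e.
  have e0 : 0 < e by rewrite invr_gt0.
  (* [Y] is a step function with [Y <= Z <= Y + e] whose steps lie in the
     sub-sigma-algebra. *)
  pose m := (Num.truncn (2 * b / e)).+1.
  pose c w := \sum_(j < m) (j.+1%:R <= (Z w + b) / e)%R%:R : R.
  pose Y w := e * c w - b.
  have Gc (j : 'I_m) : <<s G >> [set w | j.+1%:R <= (Z w + b) / e].
    have [mZ _] := GZ.
    have mZ' : measurable_fun setT
        ((fun w => (Z w + b) / e) : g_sigma_algebraType G -> R).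
      by apply: measurable_funM => //; apply: measurable_funD.
    have mj : measurable_fun setT
        ((fun=> j.+1%:R) : g_sigma_algebraType G -> R) by exact: measurable_cst.
    have := measurable_fun_ler mj mZ'.
    by move=> /(_ measurableT [set true] I); rewrite setTI.
  have bc (j : 'I_m) : bounded_measurable (fun w => (j.+1%:R <= (Z w + b) / e)%R%:R : R).
    by apply: bounded_measurable_bool; exact: G_measurable.
  have bcs : bounded_measurable c by apply: bounded_measurable_sum.
  have bY : bounded_measurable Y.
    apply: bounded_measurableB; last exact: bounded_measurable_cst.
    by apply: bounded_measurableM => //; exact: bounded_measurable_cst.
  have YZ w : Y w <= Z w <= Y w + e.
    have /andP[zl zu] : - b <= Z w <= b by rewrite -ler_norml.
    have /threshold_count/andP[h1 h2] : 0 <= (Z w + b) / e <= m%:R.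
      apply/andP; split; first by rewrite divr_ge0 ?(ltW e0)//; lra.
      apply: ltW; apply: le_lt_trans (truncnS_gt _).
      by rewrite ler_pM2r ?invr_gt0//; lra.
    rewrite -/(c w) ler_pdivlMr// in h1; rewrite -/(c w) ler_pdivrMr// in h2.
    by rewrite /Y; apply/andP; split; lra.
  have meanY : mean (fun w => Y w * (E w)%:R) = mean (fun w => Y w * p w).
    have expand q : bounded_measurable q -> mean (fun w => Y w * q w) =
        e * (\sum_(j < m) mean (fun w => (j.+1%:R <= (Z w + b) / e)%R%:R * q w))
        - b * mean q.
      move=> bq; rewrite -mean_sum; last by move=> j; apply: bounded_measurableM.
      have bs : bounded_measurable (fun w =>
          \sum_(j < m) (j.+1%:R <= (Z w + b) / e)%R%:R * q w).
        by apply: bounded_measurable_sum => j _; apply: bounded_measurableM.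
      rewrite -!meanZ// -meanB.
      - by apply: eq_mean => w; rewrite /Y /c -mulr_suml; ring.
      - by apply: bounded_measurableM => //; exact: bounded_measurable_cst.
      - by apply: bounded_measurableM => //; exact: bounded_measurable_cst.
    rewrite !expand//; congr (_ * _ - _ * _).
      by apply: eq_bigr => j _; exact: indE.
    have := indE xpredT; rewrite (_ : [set w | xpredT w] = setT); last first.
      by apply/seteqP; split.
    have GT : <<s G >> setT by exact: (@measurableT _ (g_sigma_algebraType G)).
    move=> /(_ GT).
    by congr (_ = _); apply: eq_mean => w; rewrite mul1r.
  have bnd q : bounded_measurable q -> (forall w, 0 <= q w <= 1) ->
      mean (fun w => Y w * q w) <= mean (fun w => Z w * q w) <=
      mean (fun w => Y w * q w) + e.
    move=> bq q01.
    have bYq : bounded_measurable (fun w => Y w * q w) by apply: bounded_measurableM.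
    have bZq : bounded_measurable (fun w => Z w * q w) by apply: bounded_measurableM.
    apply/andP; split.
      apply: le_mean => // w; have /andP[? ?] := q01 w.
      by rewrite ler_wpM2r//; have /andP[] := YZ w.
    rewrite -[X in _ + X](mean_cst e) -meanD//; last exact: bounded_measurable_cst.
    apply: le_mean => //.
      by apply: bounded_measurableD => //; exact: bounded_measurable_cst.
    by move=> w; have /andP[? ?] := q01 w; have /andP[? ?] := YZ w; nra.
  have E01 w : 0 <= ((E w)%:R : R) <= 1 by case: (E w); rewrite ?lexx ?ler01.
  have /andP[? ?] := bnd _ bE E01; have /andP[? ?] := bnd _ bp p01.
  by rewrite ler_norml; apply/andP; split; lra.
apply/eqP; rewrite -subr_eq0 -normr_le0; apply/ler_addgt0Pr => e e0.
rewrite add0r; apply: le_trans (step (Num.truncn e^-1)) _.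
rewrite -[leRHS]invrK lef_pV2 ?posrE ?invr_gt0//.
exact: ltW (truncnS_gt _).
Qed.

End SubSigmaAlgebra.
End Expectation.

(** * Likelihood-ratio martingale and maximal inequality *)

Section LikelihoodRatio.
Context {R : realType} {d N : nat}.

Definition likelihood_ratio (theta theta' : 'cV[R]_d) (X : 'M[R]_(d, N))
    (Q : {set 'I_N}) (r : 'I_N -> bool) : R :=
  expR (round_log_lik X Q r theta - round_log_lik X Q r theta').

Lemma mu_item_gt0 (X : 'M[R]_(d, N)) (Q : {set 'I_N}) (theta : 'cV[R]_d) i :
  0 < mu_item X Q theta i.
Proof. by rewrite mu_itemE divr_gt0 ?expR_gt0 ?logit_sum_gt0. Qed.

Lemma mu_none_gt0 (X : 'M[R]_(d, N)) (Q : {set 'I_N}) (theta : 'cV[R]_d) :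
  0 < mu_none X Q theta.
Proof. by rewrite mu_noneE invr_gt0 logit_sum_gt0. Qed.

(** At most one response is 1, so the exponential picks out a single ratio and becomes an affine
    function of the responses. *)
Lemma likelihood_ratioE theta theta' (X : 'M[R]_(d, N)) (Q : {set 'I_N}) (r : 'I_N -> bool) :
  (\sum_(i in Q) r i <= 1)%N ->
  likelihood_ratio theta theta' X Q r =
  \sum_(i in Q) (r i)%:R * (mu_item X Q theta i / mu_item X Q theta' i)
  + (1 - \sum_(i in Q) (r i)%:R) * (mu_none X Q theta / mu_none X Q theta').
Proof.
rewrite /likelihood_ratio /round_log_lik => single.
have [i0 /andP[i0Q ri0]|none] := pickP (fun i => (i \in Q) && r i).
  have pickE (f : 'I_N -> R) : \sum_(i in Q) (r i)%:R * f i = f i0.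
    rewrite (bigD1 i0)//= ri0 mul1r big1 ?addr0// => i /andP[iQ ii0].
    move: single; rewrite (bigD1 i0)//= ri0 (bigD1 i) ?iQ//=.
    by case: (r i); rewrite ?mul0r.
  have sum1 : \sum_(i in Q) (r i)%:R = 1 :> R.
    by rewrite -[RHS](pickE (fun=> 1)); apply: eq_bigr => i _; rewrite mulr1.
  rewrite !pickE sum1 subrr !mul0r !addr0 expRB !lnK ?posrE//;
  exact: mu_item_gt0.
have noneE (f : 'I_N -> R) : \sum_(i in Q) (r i)%:R * f i = 0.
  by rewrite big1// => i iQ; have := none i; rewrite iQ /= => ->; rewrite mul0r.
have sum0 : \sum_(i in Q) (r i)%:R = 0 :> R.
  by rewrite -[RHS](noneE (fun=> 1)); apply: eq_bigr => i _; rewrite mulr1.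
rewrite !noneE sum0 subr0 !mul1r !add0r expRB !lnK ?posrE//;
exact: mu_none_gt0.
Qed.

Definition innovation_gain (theta theta' : 'cV[R]_d) i (X : 'M[R]_(d, N))
    (Q : {set 'I_N}) : R :=
  (i \in Q)%:R * (mu_item X Q theta i / mu_item X Q theta' i
                  - mu_none X Q theta / mu_none X Q theta').

(* The increment of the likelihood ratio is a predictable combination of centred
   responses, so only the conditional laws of the single items are needed. *)
Lemma likelihood_ratio_innovation theta theta' (X : 'M[R]_(d, N)) (Q : {set 'I_N})
    (r : 'I_N -> bool) :
  (\sum_(i in Q) r i <= 1)%N ->
  likelihood_ratio theta theta' X Q r =
  1 + \sum_i innovation_gain theta theta' i X Q *
    ((r i)%:R - (if i \in Q then mu_item X Q theta' i else 0)).
Proof.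
move=> single; rewrite likelihood_ratioE//.
set c := mu_none X Q theta / mu_none X Q theta'.
have -> : \sum_i innovation_gain theta theta' i X Q *
    ((r i)%:R - (if i \in Q then mu_item X Q theta' i else 0)) =
  \sum_(i in Q) ((r i)%:R * (mu_item X Q theta i / mu_item X Q theta' i)
    - c * (r i)%:R - mu_item X Q theta i + c * mu_item X Q theta' i).
  rewrite [RHS]big_mkcond; apply: eq_bigr => i _; rewrite /innovation_gain -/c.
  case: ifP => _; last by rewrite !mul0r.
  by rewrite mul1r; field; rewrite gt_eqF ?mu_item_gt0.
rewrite big_split sumrB sumrB -!mulr_sumr /=.
have h1 : \sum_(i in Q) mu_item X Q theta i = 1 - mu_none X Q theta.
  by rewrite /mu_none subKr.
have h2 : \sum_(i in Q) mu_item X Q theta' i = 1 - mu_none X Q theta'.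
  by rewrite /mu_none subKr.
have h3 : c * mu_none X Q theta' = mu_none X Q theta.
  by rewrite /c divfK// gt_eqF// mu_none_gt0.
rewrite h1 h2 mulrBr h3; ring.
Qed.

Section RoundMeasurable.
Context {disp : measure_display} {O : measurableType disp}.
Variables (X : O -> 'M[R]_(d, N)) (Q : O -> {set 'I_N}).
Hypotheses
  (mX : forall k i, measurable_fun setT (fun w => X w k i))
  (X1 : forall w i, norm2 (col i (X w)) <= 1)
  (mQ : forall A : {set 'I_N}, measurable [set w | Q w = A]).

Lemma bounded_measurable_utility theta i :
  bounded_measurable (fun w => utility (X w) theta i).
Proof.
split; last by exists (norm2 theta) => w; exact: utility_le.
under eq_fun do rewrite utilityE.
by apply: measurable_sum => k; apply: measurable_funM.
Qed.

Lemma bounded_measurable_logit_sum (A : {set 'I_N}) theta :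
  bounded_measurable (fun w => logit_sum A (utility (X w) theta)).
Proof.
apply: bounded_measurableD; first exact: bounded_measurable_cst.
apply: bounded_measurable_sum => i _; apply: bounded_measurable_expR.
exact: bounded_measurable_utility.
Qed.

Lemma bounded_measurable_mu_item (A : {set 'I_N}) theta i :
  bounded_measurable (fun w => mu_item (X w) A theta i).
Proof.
apply: bounded_measurableM.
  by apply: bounded_measurable_expR; exact: bounded_measurable_utility.
apply: bounded_measurableV => [w|]; first exact: logit_sum_ge1.
by case: (bounded_measurable_logit_sum A theta).
Qed.

Lemma bounded_measurable_mu (A : {set 'I_N}) theta :
  bounded_measurable (fun w => mu (X w) A theta).
Proof. by apply: bounded_measurable_sum => i _; exact: bounded_measurable_mu_item. Qed.

Lemma bounded_measurable_item_ratio (A : {set 'I_N}) theta theta' i :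
  bounded_measurable (fun w => mu_item (X w) A theta i / mu_item (X w) A theta' i).
Proof.
apply: bounded_measurableM; first exact: bounded_measurable_mu_item.
apply: (bounded_measurable_eq _ (fun w =>
    logit_sum A (utility (X w) theta') * expR (0 - utility (X w) theta' i))) => [w|].
  by rewrite mu_itemE invf_div sub0r expRN.
apply: bounded_measurableM; first exact: bounded_measurable_logit_sum.
apply: bounded_measurable_expR; apply: bounded_measurableB.
  exact: bounded_measurable_cst.
exact: bounded_measurable_utility.
Qed.

Lemma bounded_measurable_none_ratio (A : {set 'I_N}) theta theta' :
  bounded_measurable (fun w => mu_none (X w) A theta / mu_none (X w) A theta').
Proof.
apply: (bounded_measurable_eq _ (fun w =>
  (1 - mu (X w) A theta) * logit_sum A (utility (X w) theta'))) => [w|].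
  by rewrite [in X in _ / X]mu_noneE invrK.
apply: bounded_measurableM; last exact: bounded_measurable_logit_sum.
by apply: bounded_measurableB; [exact: bounded_measurable_cst|exact: bounded_measurable_mu].
Qed.

Lemma bounded_measurable_gain theta theta' i :
  bounded_measurable (fun w => innovation_gain theta theta' i (X w) (Q w)).
Proof.
apply: (bounded_measurable_select Q
  (fun A w => innovation_gain theta theta' i (X w) A)) => // A.
apply: bounded_measurableM; first exact: bounded_measurable_cst.
apply: bounded_measurableB; first exact: bounded_measurable_item_ratio.
exact: bounded_measurable_none_ratio.
Qed.

Lemma bounded_measurable_response_law theta i :
  bounded_measurable (fun w => if i \in Q w then mu_item (X w) (Q w) theta i else 0).
Proof.
apply: (bounded_measurable_select Q
  (fun A w => if i \in A then mu_item (X w) A theta i else 0)) => // A.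
case: (i \in A); first exact: bounded_measurable_mu_item.
exact: bounded_measurable_cst.
Qed.

Lemma bounded_measurable_ratio (r : O -> 'I_N -> bool) theta theta' :
  (forall i, measurable [set w | r w i]) ->
  (forall w, (\sum_(i in Q w) r w i <= 1)%N) ->
  bounded_measurable (fun w => likelihood_ratio theta theta' (X w) (Q w) (r w)).
Proof.
move=> mr single; apply: (bounded_measurable_eq _ _ (fun w =>
  likelihood_ratio_innovation theta theta' (X w) (Q w) (r w) (single w))).
apply: bounded_measurableD; first exact: bounded_measurable_cst.
apply: bounded_measurable_sum => i _; apply: bounded_measurableM.
  exact: bounded_measurable_gain.
apply: bounded_measurableB; first exact: bounded_measurable_bool.
exact: bounded_measurable_response_law.
Qed.

End RoundMeasurable.

Section Mixture.
Context {Omega : Type} {I : finType}.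
Variables (X : nat -> Omega -> 'M[R]_(d, N)) (Q : nat -> Omega -> {set 'I_N})
  (r : nat -> Omega -> 'I_N -> bool) (theta_star : 'cV[R]_d)
  (prior : I -> R) (grid : I -> 'cV[R]_d) (c : R).

Definition mixture_ratio (t : nat) (w : Omega) : R :=
  \sum_k prior k * \prod_(1 <= s < t.+1)
    likelihood_ratio (grid k) theta_star (X s w) (Q s w) (r s w).

(** Survival up to round [t]; it replaces the stopping time at which the mixture first exceeds
    [c]. *)
Fixpoint below (t : nat) (w : Omega) : bool :=
  if t is s.+1 then below s w && (mixture_ratio t w <= c) else true.

Lemma belowP t s w : below t w -> (1 <= s <= t)%N -> mixture_ratio s w <= c.
Proof.
elim: t => [|t IH] /=; first by rewrite leqn0; case: s.
move=> /andP[bt mt] /andP[s1]; rewrite leq_eqVlt => /predU1P[->//|st].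
by apply: IH => //; rewrite s1.
Qed.

End Mixture.

End LikelihoodRatio.

Section MixtureMeasurable.
Context {R : realType} {d N : nat} {disp : measure_display}
  {O : measurableType disp} {I : finType}.
Variables (X : nat -> O -> 'M[R]_(d, N)) (Q : nat -> O -> {set 'I_N})
  (r : nat -> O -> 'I_N -> bool) (theta_star : 'cV[R]_d)
  (prior : I -> R) (grid : I -> 'cV[R]_d) (c : R) (n : nat).
Hypotheses
  (mX : forall s k i, (1 <= s <= n)%N -> measurable_fun setT (fun w => X s w k i))
  (X1 : forall s w i, (1 <= s <= n)%N -> norm2 (col i (X s w)) <= 1)
  (mQ : forall s (A : {set 'I_N}), (1 <= s <= n)%N -> measurable [set w | Q s w = A])
  (mr : forall s i, (1 <= s <= n)%N -> measurable [set w | r s w i])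
  (single : forall s w, (1 <= s <= n)%N -> (\sum_(i in Q s w) r s w i <= 1)%N).

(** Over an arbitrary measurable space, as it serves both for the full sigma-algebra and for the
    history before a response. *)
Lemma bounded_measurable_path theta t : (t <= n)%N ->
  bounded_measurable (fun w => \prod_(1 <= s < t.+1)
    likelihood_ratio theta theta_star (X s w) (Q s w) (r s w)).
Proof.
move=> tn; apply: (bounded_measurable_eq _ (fun w =>
   \prod_(1 <= s < t.+1 | (1 <= s < t.+1)%N && true)
    likelihood_ratio theta theta_star (X s w) (Q s w) (r s w))) => [w|].
  by rewrite big_nat_cond.
apply: bounded_measurable_prod => s /[!andbT] /andP[s1 st].
have sn : (1 <= s <= n)%N by rewrite s1 /=; rewrite ltnS in st; exact: leq_trans tn.
by apply: bounded_measurable_ratio => *; [exact: mX|exact: X1|exact: mQ|exact: mr|exact: single].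
Qed.

Lemma bounded_measurable_mixture t : (t <= n)%N ->
  bounded_measurable (mixture_ratio X Q r theta_star prior grid t).
Proof.
move=> tn; apply: bounded_measurable_sum => k _; apply: bounded_measurableM.
  exact: bounded_measurable_cst.
exact: bounded_measurable_path.
Qed.

Lemma measurable_below t : (t <= n)%N ->
  measurable [set w | below X Q r theta_star prior grid c t w].
Proof.
elim: t => [|t IH] tn /=.
  by rewrite (_ : [set _ | _] = setT)//; apply/seteqP; split.
rewrite (_ : [set _ | _] = [set w | below X Q r theta_star prior grid c t w] `&`
    [set w | mixture_ratio X Q r theta_star prior grid t.+1 w <= c]); last first.
  by apply/seteqP; split=> w /= /andP.
apply: measurableI; first by apply: IH; exact: ltnW.
have [mM _] := bounded_measurable_mixture _ tn.
have mc : measurable_fun setT ((fun=> c) : O -> R) by exact: measurable_cst.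
have := measurable_fun_ler mM mc.
by move=> /(_ measurableT [set true] Logic.I); rewrite setTI.
Qed.

End MixtureMeasurable.

Section Ville.
Context {R : realType} {d N K T : nat} {kappa L S : R}
  {Theta : set 'cV[R]_d} {theta_star : 'cV[R]_d}
  {disp : measure_display} {Omega : measurableType disp}
  {P : probability Omega R}
  {X : nat -> Omega -> 'M[R]_(d, N)} {Q : nat -> Omega -> {set 'I_N}}
  {r : nat -> Omega -> 'I_N -> bool}.
Hypothesis model : mnl_model K T kappa L S Theta theta_star P X Q r.

Definition history_generators (t : nat) : set (set Omega) :=
  [set A | exists s k i (B : set R), [/\ (1 <= s <= t)%N, measurable B &
                 A = [set w | B (X s w k i)]]]
      `|` [set A | exists s (Q0 : {set 'I_N}), (1 <= s <= t)%N /\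
                 A = [set w | Q s w = Q0]]
      `|` [set A | exists s i, (1 <= s < t)%N /\ A = [set w | r s w i]].

Lemma history_measurable t : (t <= T)%N ->
  <<s history_generators t >> `<=` measurable.
Proof.
move=> tT; apply: smallest_sub; first exact: sigma_algebra_measurable.
have le s : (1 <= s <= t)%N -> (1 <= s <= T)%N.
  by move=> /andP[-> st]; exact: leq_trans tT.
move=> A [[|]|].
- move=> [s [k [i [B [st mB ->]]]]].
  have := model_context_meas model k i (le _ st).
  by move=> /(_ measurableT _ mB); rewrite setTI.
- by move=> [s [Q0 [st ->]]]; apply: (model_assortment_meas model); exact: le.
- move=> [s [i [/andP[s1 st] ->]]]; apply: (model_response_meas model).
  by apply: le; rewrite s1 ltnW.
Qed.

Section History.
Variable t : nat.
Hypothesis tT : (t <= T)%N.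
Local Notation H := (g_sigma_algebraType (history_generators t)).

Lemma history_context s k i : (1 <= s <= t)%N ->
  measurable_fun setT ((fun w => X s w k i) : H -> R).
Proof.
move=> st _ B mB; rewrite setTI; apply: sub_sigma_algebra.
by left; left; exists s, k, i, B.
Qed.

Lemma history_assortment s (A : {set 'I_N}) : (1 <= s <= t)%N ->
  measurable ([set w | Q s w = A] : set H).
Proof. by move=> st; apply: sub_sigma_algebra; left; right; exists s, A. Qed.

Lemma history_response s i : (1 <= s < t)%N ->
  measurable ([set w | r s w i] : set H).
Proof. by move=> st; apply: sub_sigma_algebra; right; exists s, i. Qed.

End History.

(** The martingale property in integrated form, against every bounded [Y] determined by the history:
    each gain is known before the response, so each innovation has mean zero even after
    multiplication by [Y]. *)
Lemma mean_likelihood_ratio t theta (Y : Omega -> R) : (1 <= t <= T)%N ->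
  bounded_measurable (Y : g_sigma_algebraType (history_generators t) -> R) ->
  mean P (fun w => Y w * likelihood_ratio theta theta_star (X t w) (Q t w) (r t w))
  = mean P Y.
Proof.
move=> tT HY; have /andP[t1 tT'] := tT.
have tt : (1 <= t <= t)%N by rewrite t1 leqnn.
have X1 w i := model_context_norm model w i tT.
pose p i w := if i \in Q t w then mu_item (X t w) (Q t w) theta_star i else 0.
pose g i w := innovation_gain theta theta_star i (X t w) (Q t w).
have Hg i : bounded_measurable
    (g i : g_sigma_algebraType (history_generators t) -> R).
  apply: bounded_measurable_gain => //.
  - by move=> k j; exact: history_context.
  - by move=> A; exact: history_assortment.
have Hp i : bounded_measurable
    (p i : g_sigma_algebraType (history_generators t) -> R).
  apply: bounded_measurable_response_law => //.
  - by move=> k j; exact: history_context.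
  - by move=> A; exact: history_assortment.
have sub (f : Omega -> R) := bounded_measurable_sub _ (history_measurable _ tT') f.
have bY := sub _ HY; have bg i := sub _ (Hg i); have bp i := sub _ (Hp i).
have mr i := model_response_meas model i tT.
have br i : bounded_measurable (fun w => (r t w i)%:R : R).
  exact: bounded_measurable_bool.
have HYg i : bounded_measurable
    ((fun w => Y w * g i w) : g_sigma_algebraType (history_generators t) -> R).
  exact: bounded_measurableM.
have p01 i w : 0 <= p i w <= 1.
  rewrite /p; case: ifP => iQ; last by rewrite lexx ler01.
  rewrite ltW ?mu_item_gt0//=.
  apply: (@le_trans _ _ (mu (X t w) (Q t w) theta_star)).
    rewrite /mu (bigD1 i)//= lerDl sumr_ge0// => j _.
    exact: ltW (mu_item_gt0 _ _ _ _).
  by rewrite muE lerBlDr lerDl invr_ge0 ltW// logit_sum_gt0.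
have cond i : mean P (fun w => Y w * g i w * (r t w i)%:R) =
    mean P (fun w => Y w * g i w * p i w).
  apply: (mean_cond_prob _ _ (history_measurable _ tT') (fun w => r t w i)) => //.
  exact: (model_response_law model i tT).
have expand w : Y w * likelihood_ratio theta theta_star (X t w) (Q t w) (r t w) =
    Y w + \sum_i (Y w * g i w * (r t w i)%:R - Y w * g i w * p i w).
  rewrite likelihood_ratio_innovation; last exact: (model_response_single model w tT).
  rewrite mulrDr mulr1 mulr_sumr; congr (_ + _); apply: eq_bigr => i _.
  by rewrite -mulrBr mulrA.
rewrite (eq_mean _ _ _ expand).
have bterm i : bounded_measurable
    (fun w => Y w * g i w * (r t w i)%:R - Y w * g i w * p i w).
  apply: bounded_measurableB; apply: bounded_measurableM => //;
  exact: bounded_measurableM.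
rewrite meanD//; last exact: bounded_measurable_sum.
rewrite mean_sum// big1 ?addr0// => i _.
rewrite meanB ?cond ?subrr//; apply: bounded_measurableM => //;
exact: bounded_measurableM.
Qed.

(** By induction on the round, the mean of the surviving mixture plus [c] times the probability of
    having crossed [c] stays at most its initial value 1. Dropping the nonnegative mixture leaves a
    crossing probability of at most [c^-1 = delta]. *)
Lemma mixture_ville {I : finType} (prior : I -> R) (grid : I -> 'cV[R]_d)
    (delta : R) : 0 < delta <= 1 ->
  (forall k, 0 <= prior k) -> \sum_k prior k = 1 ->
  let good := below X Q r theta_star prior grid delta^-1 T in
  measurable [set w | good w] /\ ((1 - delta)%:E <= P [set w | good w])%E.
Proof.
move=> /andP[delta0 delta1] prior0 prior1 good.
pose c := delta^-1.
have c0 : 0 < c by rewrite invr_gt0.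
pose M := mixture_ratio X Q r theta_star prior grid.
pose B := below X Q r theta_star prior grid c.
have bM t : (t <= T)%N -> bounded_measurable (M t).
  apply: bounded_measurable_mixture => s *.
  - exact: (model_context_meas model _ _ _).
  - exact: (model_context_norm model _ _ _).
  - exact: (model_assortment_meas model _ _).
  - exact: (model_response_meas model _ _).
  - exact: (model_response_single model _ _).
have mB t : (t <= T)%N -> measurable [set w | B t w].
  apply: measurable_below => s *.
  - exact: (model_context_meas model _ _ _).
  - exact: (model_context_norm model _ _ _).
  - exact: (model_assortment_meas model _ _).
  - exact: (model_response_meas model _ _).
  - exact: (model_response_single model _ _).
have bB t : (t <= T)%N -> bounded_measurable (fun w => (B t w)%:R : R).
  by move=> tT; apply: bounded_measurable_bool; exact: mB.
have M0 t w : 0 <= M t w.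
  apply: sumr_ge0 => k _; rewrite mulr_ge0//; apply: prodr_ge0 => s _.
  exact: expR_ge0.
(* The past likelihood ratios and survival up to [t] belong to the history before the response of
   round [t.+1], so the new ratio integrates out. *)
have step t : (t < T)%N ->
    mean P (fun w => M t.+1 w * (B t w)%:R) = mean P (fun w => M t w * (B t w)%:R).
  move=> tT; have t1T : (1 <= t.+1 <= T)%N by [].
  have le s : (1 <= s <= t)%N -> (1 <= s <= t.+1)%N.
    by move=> /andP[-> /leq_trans]; apply.
  have leT s : (1 <= s <= t)%N -> (1 <= s <= T)%N.
    by move=> /andP[-> st]; exact: leq_trans (ltnW tT).
  pose path k w := \prod_(1 <= s < t.+1)
    likelihood_ratio (grid k) theta_star (X s w) (Q s w) (r s w).
  have Hpath k : bounded_measurable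
      (path k : g_sigma_algebraType (history_generators t.+1) -> R).
    apply: (@bounded_measurable_path _ _ _ _
       (g_sigma_algebraType (history_generators t.+1)) X Q r theta_star t) => // s *.
    - by apply: history_context; exact: le.
    - by apply: (model_context_norm model); exact: leT.
    - by apply: history_assortment; exact: le.
    - by apply: history_response.
    - by apply: (model_response_single model); exact: leT.
  have HB : bounded_measurable ((fun w => (B t w)%:R)
      : g_sigma_algebraType (history_generators t.+1) -> R).
    apply: bounded_measurable_bool.
    apply: (@measurable_below _ _ _ _
       (g_sigma_algebraType (history_generators t.+1)) _ X Q r _ _ _ _ t) => // s *.
    - by apply: history_context; exact: le.
    - by apply: (model_context_norm model); exact: leT.
    - by apply: history_assortment; exact: le.
    - by apply: history_response.
    - by apply: (model_response_single model); exact: leT.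
  have HY k : bounded_measurable ((fun w => path k w * (B t w)%:R)
      : g_sigma_algebraType (history_generators t.+1) -> R).
    exact: bounded_measurableM.
  have sub (f : Omega -> R) := bounded_measurable_sub _ (history_measurable _ tT) f.
  have bY k := sub _ (HY k).
  pose rho k w := likelihood_ratio (grid k) theta_star (X t.+1 w) (Q t.+1 w) (r t.+1 w).
  have brho k : bounded_measurable (rho k).
    apply: bounded_measurable_ratio.
    - by move=> k' i; exact: (model_context_meas model _ _ t1T).
    - by move=> w i; exact: (model_context_norm model _ _ t1T).
    - by move=> A; exact: (model_assortment_meas model _ t1T).
    - by move=> i; exact: (model_response_meas model _ t1T).
    - by move=> w; exact: (model_response_single model _ t1T).
  have -> : mean P (fun w => M t.+1 w * (B t w)%:R) =
     mean P (fun w => \sum_k prior k * (path k w * (B t w)%:R * rho k w)).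
    apply: eq_mean => w; rewrite /M /mixture_ratio mulr_suml.
    by apply: eq_bigr => k _; rewrite big_nat_recr//= -/(path k w) -/(rho k w); ring.
  have -> : mean P (fun w => M t w * (B t w)%:R) =
     mean P (fun w => \sum_k prior k * (path k w * (B t w)%:R)).
    apply: eq_mean => w; rewrite /M /mixture_ratio mulr_suml.
    by apply: eq_bigr => k _; rewrite mulrA.
  have cst k : bounded_measurable ((fun=> prior k) : Omega -> R).
    exact: bounded_measurable_cst.
  rewrite !mean_sum.
  - apply: eq_bigr => k _; rewrite !meanZ//; last exact: bounded_measurableM.
    by congr (_ * _); exact: mean_likelihood_ratio.
  - by move=> k; exact: bounded_measurableM.
  - by move=> k; do 2 apply: bounded_measurableM => //.
(* Paying [c] at the first time the mixture exceeds [c] is a losing trade for a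
   martingale, so this quantity never increases. *)
have inv t : (t <= T)%N ->
    mean P (fun w => M t w * (B t w)%:R) + c * (1 - mean P (fun w => (B t w)%:R)) <= 1.
  elim: t => [|t IH] tT.
    have -> : mean P (fun w => M 0%N w * (B 0%N w)%:R) = 1.
      rewrite -[RHS](mean_cst P 1); apply: eq_mean => w.
      rewrite /M /mixture_ratio /= mulr1 -[RHS]prior1; apply: eq_bigr => k _.
      by rewrite big_nil mulr1.
    by rewrite /= mean_cst subrr mulr0 addr0.
  apply: le_trans (IH (ltnW tT)); rewrite -(step t)//.
  have bMB1 : bounded_measurable (fun w => M t.+1 w * (B t.+1 w)%:R).
    by apply: bounded_measurableM; [exact: bM|exact: bB].
  have bMB : bounded_measurable (fun w => M t.+1 w * (B t w)%:R).
    by apply: bounded_measurableM; [exact: bM|apply: bB; exact: ltnW].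
  have bc : bounded_measurable ((fun=> c) : Omega -> R) by exact: bounded_measurable_cst.
  have bB1 := bB _ tT; have bB0 := bB _ (ltnW tT).
  suff : mean P (fun w => M t.+1 w * (B t.+1 w)%:R + c * (B t w)%:R) <=
      mean P (fun w => M t.+1 w * (B t w)%:R + c * (B t.+1 w)%:R).
    rewrite !meanD ?(meanZ _ c _ bB0) ?(meanZ _ c _ bB1)//; first lra.
    - exact: bounded_measurableM.
    - exact: bounded_measurableM.
  apply: le_mean.
  - by apply: bounded_measurableD => //; exact: bounded_measurableM.
  - by apply: bounded_measurableD => //; exact: bounded_measurableM.
  (* The two sides differ only at a first crossing, where they are [c] and the mixture, which
     exceeds [c]. *)
  move=> w; rewrite /B /= -/(B t w) -/(M t.+1 w).
  have e1 : true%:R = 1 :> R by [].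
  have e0 : false%:R = 0 :> R by [].
  case: (B t w) => /=; last by rewrite e0 !mulr0.
  by case: (leP (M t.+1 w) c) => cM; rewrite ?e1 ?e0; lra.
have goodE : mean P (fun w => (B T w)%:R) >= 1 - delta.
  have := inv T (leqnn T).
  have : 0 <= mean P (fun w => M T w * (B T w)%:R).
    rewrite -[X in X <= _](mean_cst P 0); apply: le_mean => [||w].
    - exact: bounded_measurable_cst.
    - by apply: bounded_measurableM; [exact: bM|exact: bB].
    - by rewrite mulr_ge0.
  move=> h1 h2; have : c * (1 - mean P (fun w => (B T w)%:R)) <= 1 by lra.
  by rewrite mulrC -ler_pdivlMr// /c invrK mul1r; lra.
split; first exact: mB.
by rewrite -mean_bool ?lee_fin//; exact: mB.
Qed.

End Ville.

(** * Coverage of the confidence sets *)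

Section ConfidenceSet.
Context {R : realType} {d N : nat}.

Lemma round_log_lik_le0 (X : 'M[R]_(d, N)) (Q : {set 'I_N}) (r : 'I_N -> bool)
    theta :
  (\sum_(i in Q) r i <= 1)%N -> round_log_lik X Q r theta <= 0.
Proof.
move=> single; rewrite /round_log_lik -oppr_ge0 opprD addr_ge0//.
  rewrite -sumrN sumr_ge0// => i iQ; rewrite -mulrN mulr_ge0// oppr_ge0 ln_le0//.
  apply: (@le_trans _ _ (mu X Q theta)).
    rewrite /mu (bigD1 i)//= lerDl sumr_ge0// => j _.
    exact: ltW (mu_item_gt0 _ _ _ _).
  by rewrite muE lerBlDr lerDl invr_ge0 ltW// logit_sum_gt0.
rewrite -mulrN mulr_ge0//.
  by rewrite subr_ge0 -natr_sum -[1]/(1%:R) ler_nat.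
by rewrite oppr_ge0 ln_le0// mu_noneE invf_le1 ?logit_sum_gt0 ?logit_sum_ge1.
Qed.

Lemma round_log_lik0 (X : 'M[R]_(d, N)) (Q : {set 'I_N}) (r : 'I_N -> bool) :
  - ln (1 + N%:R) <= round_log_lik X Q r 0.
Proof.
have u0 i : utility X 0 i = 0 by rewrite /utility mulmx0 mxE.
rewrite round_log_likE big1 => [|i _]; last by rewrite u0 mulr0.
rewrite sub0r lerN2 ler_ln ?posrE ?logit_sum_gt0 ?ltr_pwDl//.
rewrite /logit_sum lerD2l.
under eq_bigr do rewrite u0 expR0.
by rewrite sumr_const ler_nat -[X in (_ <= X)%N]card_ord max_card.
Qed.

Variables (lam : nat -> R) (X : nat -> 'M[R]_(d, N)) (Q : nat -> {set 'I_N})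
  (r : nat -> 'I_N -> bool) (t : nat).
Hypotheses (lam_gt0 : 0 < lam t)
  (X1 : forall s i, (1 <= s < t)%N -> norm2 (col i (X s)) <= 1)
  (single : forall s, (1 <= s < t)%N -> (\sum_(i in Q s) r s i <= 1)%N).

Lemma log_lik_midpoint_ge theta v :
  2 * log_lik lam X Q r t theta - (lam t + t%:R) * norm2 v ^+ 2 <=
  log_lik lam X Q r t (theta + v) + log_lik lam X Q r t (theta - v).
Proof.
rewrite !log_likE.
have sums : 2 * (\sum_(1 <= s < t) round_log_lik (X s) (Q s) (r s) theta)
    - t%:R * norm2 v ^+ 2 <=
    \sum_(1 <= s < t) round_log_lik (X s) (Q s) (r s) (theta + v)
    + \sum_(1 <= s < t) round_log_lik (X s) (Q s) (r s) (theta - v).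
  rewrite -big_split /=.
  apply: (@le_trans _ _ (\sum_(1 <= s < t)
     (2 * round_log_lik (X s) (Q s) (r s) theta - norm2 v ^+ 2))).
    rewrite sumrB -mulr_sumr lerD2l lerN2 sumr_const_nat -[leLHS]mulr_natl.
    by rewrite ler_wpM2r ?sqr_ge0// ler_nat leq_subr.
  rewrite [leLHS]big_nat_cond [leRHS]big_nat_cond.
  apply: ler_sum => s /[!andbT] st.
  by apply: round_log_lik_midpoint_ge => i _; exact: X1.
have par := norm2_parallelogram theta v.
have : lam t / 2 * (norm2 (theta + v) ^+ 2 + norm2 (theta - v) ^+ 2) =
  lam t / 2 * (2 * norm2 theta ^+ 2 + 2 * norm2 v ^+ 2) by rewrite par.
rewrite mulrDr; lra.
Qed.

(** The maximiser ranges over the whole space, so it must be confined before a grid is chosen. It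
    beats the parameter 0, whose log-likelihood is at least [- t * ln (1 + N)], while unpenalised
    log-likelihoods are nonpositive. *)
Lemma maximizer_norm_le theta_hat :
  (forall theta, log_lik lam X Q r t theta <= log_lik lam X Q r t theta_hat) ->
  norm2 theta_hat ^+ 2 <= 2 * (t%:R * ln (1 + N%:R)) / lam t.
Proof.
move=> /(_ 0); rewrite !log_likE norm20 expr0n /= mulr0 subr0 => hmax.
have l0 : 0 <= ln (1 + N%:R) :> R by rewrite ln_ge0// lerDl.
have low : - (t%:R * ln (1 + N%:R)) <=
    \sum_(1 <= s < t) round_log_lik (X s) (Q s) (r s) 0.
  apply: (@le_trans _ _ (\sum_(1 <= s < t) - ln (1 + N%:R))).
    rewrite sumrN lerN2 sumr_const_nat -[leLHS]mulr_natl ler_wpM2r// ler_nat.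
    exact: leq_subr.
  by apply: ler_sum => s _; exact: round_log_lik0.
have high : \sum_(1 <= s < t) round_log_lik (X s) (Q s) (r s) theta_hat <= 0.
  rewrite -oppr_ge0 -sumrN big_nat_cond sumr_ge0// => s /[!andbT] st.
  by rewrite oppr_ge0; apply: round_log_lik_le0; exact: single.
rewrite ler_pdivlMr// mulrC; lra.
Qed.

End ConfidenceSet.

(** * Measurability of the regret, coverage, and the final bound *)

Section Assembly.
Context {R : realType} {d N K T : nat} {kappa L S : R}
  {Theta : set 'cV[R]_d} {theta_star : 'cV[R]_d}
  {disp : measure_display} {Omega : measurableType disp}
  {P : probability Omega R}
  {X : nat -> Omega -> 'M[R]_(d, N)} {Q : nat -> Omega -> {set 'I_N}}
  {r : nat -> Omega -> 'I_N -> bool}.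
Hypothesis model : mnl_model K T kappa L S Theta theta_star P X Q r.

Lemma mixture_ratioE {I : finType} (prior : I -> R) (grid : I -> 'cV[R]_d) t w :
  mixture_ratio X Q r theta_star prior grid t w =
  (\sum_k prior k * expR (\sum_(1 <= s < t.+1)
     round_log_lik (X s w) (Q s w) (r s w) (grid k)))
  / expR (\sum_(1 <= s < t.+1) round_log_lik (X s w) (Q s w) (r s w) theta_star).
Proof.
rewrite mulr_suml; apply: eq_bigr => k _; rewrite -mulrA; congr (_ * _).
by rewrite -expRB -sumrB expR_sum.
Qed.

(** For measurability: the optimal assortment is a selection that varies with the contexts, whereas
    its value is a maximum of finitely many measurable functions. *)
Lemma mu_opt_bigmax (A0 : 'M[R]_(d, N)) (theta : 'cV[R]_d) :
  mu A0 (opt_assortment K A0 theta) theta =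
  \big[Num.max/0]_(A : {set 'I_N} | (#|A| <= K)%N) mu A0 A theta.
Proof.
have mu0 A : 0 <= mu A0 A theta.
  by apply: sumr_ge0 => i _; exact: ltW (mu_item_gt0 _ _ _ _).
apply/eqP; rewrite eq_le; apply/andP; split.
  by apply: le_bigmax_cond; exact: opt_assortment_card.
apply: bigmax_le => // A AK.
rewrite /opt_assortment; case: arg_maxP => [|B _]; first by rewrite cards0.
by apply.
Qed.

Lemma measurable_regret_le (b : R) :
  measurable [set w | regret K T theta_star (X ^~ w) (Q ^~ w) <= b].
Proof.
have mmax t : (1 <= t <= T)%N ->
    measurable_fun setT (fun w => mu (X t w) (opt_assortment K (X t w) theta_star) theta_star).
  move=> tT; rewrite (_ : (fun _ => _) = fun w =>
    \big[Num.max/0]_(A : {set 'I_N} | (#|A| <= K)%N) mu (X t w) A theta_star); last first.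
    by apply/funext => w; rewrite mu_opt_bigmax.
  elim: (index_enum _) => [|A s IH].
    rewrite (_ : (fun _ => _) = fun=> 0) ?measurable_cst//.
    by apply/funext => w; rewrite big_nil.
  case AK : (#|A| <= K)%N; last first.
    rewrite (_ : (fun _ => _) = fun w =>
      \big[Num.max/0]_(j <- s | (#|j| <= K)%N) mu (X t w) j theta_star)//.
    by apply/funext => w; rewrite big_cons AK.
  rewrite (_ : (fun _ => _) = fun w => Num.max (mu (X t w) A theta_star)
      (\big[Num.max/0]_(j <- s | (#|j| <= K)%N) mu (X t w) j theta_star)); last first.
    by apply/funext => w; rewrite big_cons AK.
  apply: measurable_maxr => //.
  have [] // := @bounded_measurable_mu R d N _ _ (X t) _ _ A theta_star.
  - by move=> k i; exact: (model_context_meas model _ _ tT).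
  - by move=> w i; exact: (model_context_norm model _ _ tT).
have mplay t : (1 <= t <= T)%N ->
    measurable_fun setT (fun w => mu (X t w) (Q t w) theta_star).
  move=> tT; have [] // := @bounded_measurable_select R _ Omega _ (Q t)
    (fun A w => mu (X t w) A theta_star).
  - by move=> A; exact: (model_assortment_meas model _ tT).
  - move=> A; apply: bounded_measurable_mu.
    + by move=> k i; exact: (model_context_meas model _ _ tT).
    + by move=> w i; exact: (model_context_norm model _ _ tT).
have mreg : measurable_fun setT
    (fun w => regret K T theta_star (X ^~ w) (Q ^~ w)).
  rewrite (_ : (fun _ => _) = fun w => \sum_(t <- index_iota 1 T.+1)
      (if (1 <= t <= T)%N then
         mu (X t w) (opt_assortment K (X t w) theta_star) theta_star
         - mu (X t w) (Q t w) theta_star else 0)); last first.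
    by apply/funext => w; rewrite /regret big_nat_cond big_mkcond; apply: eq_bigr
      => t _; rewrite andbT ltnS.
  apply: measurable_sum => t; case tT: (1 <= t <= T)%N.
    by apply: measurable_funB; [exact: mmax|exact: mplay].
  exact: measurable_cst.
have mb : measurable_fun setT ((fun=> b) : Omega -> R) by exact: measurable_cst.
have := measurable_fun_ler mreg mb.
by move=> /(_ measurableT [set true] Logic.I); rewrite setTI.
Qed.

Variables (delta : R) (lam : nat -> R)
  (theta_hat theta_opt : nat -> Omega -> 'cV[R]_d).
Hypotheses (delta01 : 0 < delta <= 1) (d_gt0 : (0 < d)%N) (KT2 : (2 <= K * T)%N)
  (lamE : forall t, (1 <= t <= T)%N -> lam t = d%:R * ln (K * T)%:R)
  (run : forall w, cb_mnl_run K T Theta S L lam delta (X ^~ w) (Q ^~ w) (r ^~ w)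
           (theta_hat ^~ w) (theta_opt ^~ w)).

Lemma model_S_ge0 : 0 <= S.
Proof. by have [th _ <-] := model_S_attained model; exact: norm2_ge0. Qed.

Lemma regularization_ge_half : 1 / 2 <= d%:R * ln (K * T)%:R :> R.
Proof.
have dR : 1 <= d%:R :> R by rewrite ler1n.
have := ln_nat_ge_half (R := R) _ KT2; nra.
Qed.

(** The grid bound and survival give [expR (F th) / C ^+ d <= delta^-1 * expR (ell theta_star)],
    with [F] penalised and [ell] not. Logarithms and the penalty at [theta_star] then lead to the
    left side of [beta_sqr_ge]. *)
Lemma confidence_set_mem : 1 / 4 <= L ->
  exists good : set Omega, [/\ measurable good, ((1 - delta)%:E <= P good)%E &
    forall w, good w -> forall t, (1 <= t <= T)%N ->
      conf_set K Theta S L lam delta (X ^~ w) (Q ^~ w) (r ^~ w)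
        (theta_hat t w) t theta_star].
Proof.
move=> L4; have S0 := model_S_ge0.
set lam0 : R := d%:R * ln (K * T)%:R.
have lam0_ge : 1 / 2 <= lam0 by exact: regularization_ge_half.
have lam0_gt0 : 0 < lam0 by lra.
have delta0 : 0 < delta by case/andP: delta01.
(* The bound of [maximizer_norm_le] at the horizon, so that one grid serves all rounds. *)
pose rho := Num.sqrt (2 * (T%:R * ln (1 + N%:R)) / lam0) : R.
have [m [x [m0 gridP]]] :=
  @gaussian_grid R lam0 (lam0 + T%:R) rho lam0_gt0 (sqrtr_ge0 _).
pose prior := @grid_prior R d m lam0 x.
pose grid := @grid_point R d m x.
have [mg Pg] := mixture_ville model prior grid delta delta01
  (grid_prior_ge0 _ _ m0) (grid_prior_sum1 _ _ m0).
exists [set w | below X Q r theta_star prior grid delta^-1 T w]; split=> //.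
move=> w gw t tT; split; first exact: (model_theta_star model).
have lamt : lam t = lam0 by exact: lamE.
have lamt0 : 0 < lam t by rewrite lamt.
have /andP[t1 tT'] := tT.
have le s : (1 <= s < t)%N -> (1 <= s <= T)%N.
  by move=> /andP[-> /ltnW/leq_trans]; apply.
have X1 s i : (1 <= s < t)%N -> norm2 (col i (X s w)) <= 1.
  by move=> st; exact: (model_context_norm model _ _ (le _ st)).
have single s : (1 <= s < t)%N -> (\sum_(i in Q s w) r s w i <= 1)%N.
  by move=> st; exact: (model_response_single model _ (le _ st)).
have [hmax _] := run w t tT.
set F := log_lik lam (X ^~ w) (Q ^~ w) (r ^~ w) t in hmax *.
set th := theta_hat t w in hmax *.
pose ell theta := \sum_(1 <= s < t)
  round_log_lik (X s w) (Q s w) (r s w) theta : R.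
have FE theta : F theta = ell theta - lam0 / 2 * norm2 theta ^+ 2.
  by rewrite /F log_likE lamt.
set A := lam0 + t%:R.
have At0 : 0 < A by rewrite /A ltr_pwDl.
set C := 16 / 5 * Num.sqrt (A / lam0).
have C0 : 0 < C by rewrite mulr_gt0 ?sqrtr_gt0 ?divr_gt0//; lra.
have thrho i : `|th i 0| <= rho.
  have : norm2 th ^+ 2 <= 2 * (T%:R * ln (1 + N%:R)) / lam0.
    apply: le_trans (maximizer_norm_le _ _ _ _ _ lamt0 single _ hmax) _.
    rewrite lamt ler_pM2r ?invr_gt0// ler_pM2l// ler_wpM2r ?ler_nat//.
    by rewrite ln_ge0// lerDl.
  move=> h; rewrite -ler_sqr ?nnegrE ?sqrtr_ge0// real_normK ?num_real//.
  have rr : rho ^+ 2 = 2 * (T%:R * ln (1 + N%:R)) / lam0.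
    by rewrite sqr_sqrtr//; apply: le_trans h; exact: sqr_ge0.
  rewrite rr; apply: le_trans h; rewrite sqr_norm2 (bigD1 i)//= lerDl.
  by rewrite sumr_ge0// => k _; exact: sqr_ge0.
have mix := @grid_mixture_ge R d m lam0 x m0 ell th (F th) A C C0.
have {}mix : expR (F th) / C ^+ d <= \sum_k prior k * expR (ell (grid k)).
  apply: mix => [u|i]; last first.
    by apply: gridP => //; rewrite /A lerDl lerD2l ler_nat tT' ler0n.
  rewrite -FE; apply: maximizer_lower_bound hmax => y v.
  have := log_lik_midpoint_ge lam (X ^~ w) (Q ^~ w) (r ^~ w) t X1 y v.
  by rewrite -/F lamt.
(* Round [t] uses the responses before [t], hence [t.-1]. Survival says nothing at index 0, where
   the mixture is 1 and [delta <= 1] concludes. *)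
have ratio_le : mixture_ratio X Q r theta_star prior grid t.-1 w <= delta^-1.
  case: t.-1 (leq_trans (leq_pred t) tT') => [|s] sT; last first.
    by apply: (belowP _ _ _ _ _ _ _ _ _ _ gw); rewrite sT.
  rewrite /mixture_ratio; under eq_bigr do rewrite big_nil mulr1.
  rewrite grid_prior_sum1// invf_ge1//; by case/andP: delta01.
rewrite mixture_ratioE prednK// in ratio_le.
have lik_le : expR (F th) / C ^+ d <= delta^-1 * expR (ell theta_star).
  by rewrite -ler_pdivrMr ?expR_gt0//; apply: le_trans ratio_le;
     rewrite ler_pM2r ?invr_gt0 ?expR_gt0.
have CE : C = 16 / 5 * Num.sqrt ((lam t + t%:R) / lam t) by rewrite lamt.
have b_ge := beta_sqr_ge _ _ _ _ _ L _ lam d_gt0 KT2 tT (lamE t tT) delta01 S0 L4.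
rewrite -CE in b_ge; apply: le_trans b_ge.
have lnle : F th - d%:R * ln C <= - ln delta + ell theta_star.
  have Cd : 0 < C ^+ d by rewrite exprn_gt0.
  have : ln (expR (F th) / C ^+ d) <= ln (delta^-1 * expR (ell theta_star)).
    by rewrite ler_ln ?posrE ?divr_gt0 ?mulr_gt0 ?invr_gt0 ?expR_gt0.
  rewrite ln_div ?posrE ?expR_gt0// lnM ?posrE ?invr_gt0 ?expR_gt0// !expRK.
  by rewrite lnXn// lnV ?posrE// mulr_natl.
have sS : lam0 / 2 * norm2 theta_star ^+ 2 <= lam t / 2 * S ^+ 2.
  rewrite lamt ler_wpM2l//; first by rewrite divr_ge0// ltW.
  rewrite ler_sqr ?nnegrE ?norm2_ge0//.
  exact: (model_S_ub model (model_theta_star model)).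
rewrite [F theta_star]FE; lra.
Qed.

Lemma regret_bound_const (Gam : R) (w : Omega) : 0 <= Gam ->
  (forall t, (1 <= t <= T)%N ->
     conf_set K Theta S L lam delta (X ^~ w) (Q ^~ w) (r ^~ w)
        (theta_hat t w) t theta_star) ->
  (forall t, (1 <= t <= T)%N ->
     Defs.beta d K S L lam delta t ^+ 2 <= lam t * Gam ^+ 2) ->
  regret K T theta_star (X ^~ w) (Q ^~ w) <=
  2 * expR (3 * S) * Num.sqrt (18 * Gam ^+ 2 / curvature S)
    * (d%:R * Num.sqrt T%:R * ln (K * T)%:R).
Proof.
move=> Gam0 good betab; have S0 := model_S_ge0.
set l := ln (K * T)%:R : R.
have l_ge : 1 / 2 <= l by exact: ln_nat_ge_half.
have lam_ge : 1 / 2 <= d%:R * l by exact: regularization_ge_half.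
have lam_gt0 : 0 < d%:R * l by lra.
have c0 := curvature_gt0 S.
have X1 t i : (1 <= t <= T)%N -> norm2 (col i (X t w)) <= 1.
  by move=> tT; exact: (model_context_norm model _ _ tT).
have ThS th : Theta th -> norm2 th <= S by exact: (model_S_ub model).
have bb t : (1 <= t <= T)%N ->
    Defs.beta d K S L lam delta t ^+ 2 <= d%:R * l * Gam ^+ 2.
  by move=> tT; rewrite -(lamE t tT); exact: betab.
have := regret_le K T Theta S L lam delta _ _ _ _ _ theta_star (d%:R * l)
  (d%:R * l * Gam ^+ 2) S0 lam_gt0 lamE ThS X1 (run w) good bb.
move/le_trans; apply; rewrite -[leRHS]mulrA.
rewrite ler_wpM2l ?mulr_ge0 ?expR_ge0//.
have dR : 0 < d%:R :> R by rewrite ltr0n.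
have lnT : ln (1 + T%:R / (d%:R * l)) <= 3 * l.
  apply: le_trans (ln_1D2n_le _ KT2).
  have T2 : T%:R / (d%:R * l) <= 2 * (K * T)%:R.
    rewrite ler_pdivrMr//.
    have : T%:R <= (K * T)%:R :> R.
      by rewrite ler_nat leq_pmull//; move: KT2; case: (K).
    by have := ler0n R (K * T); nra.
  have T0 : 0 <= T%:R / (d%:R * l) by rewrite divr_ge0// ltW.
  by rewrite ler_ln ?posrE ?lerD2l//; lra.
have li : (d%:R * l)^-1 <= 2.
  by rewrite -[leRHS]invrK lef_pV2 ?posrE ?invr_gt0//; lra.
have li0 : 0 <= (d%:R * l)^-1 by rewrite invr_ge0 ltW.
have ln0 : 0 <= ln (1 + T%:R / (d%:R * l)).
  by rewrite ln_ge0// lerDl divr_ge0// ltW.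
set H := 2 * (d%:R * l * Gam ^+ 2) / curvature S.
have H0 : 0 <= H.
  by rewrite /H divr_ge0 ?(ltW c0)// !mulr_ge0// ?sqr_ge0//; lra.
(* 18 is the 2 in [H] times 3 for [1 + (d * l)^-1] times 3 for the logarithm, at most [3 * l]. *)
have -> : Num.sqrt (18 * Gam ^+ 2 / curvature S) * (d%:R * Num.sqrt T%:R * l) =
    Num.sqrt (T%:R * (H * 3 * d%:R * (3 * l))).
  have -> : T%:R * (H * 3 * d%:R * (3 * l)) =
      18 * Gam ^+ 2 / curvature S * (T%:R * (d%:R * l) ^+ 2).
    by rewrite /H; field; rewrite gt_eqF.
  rewrite [RHS]sqrtrM; last by rewrite divr_ge0 ?(ltW c0)// mulr_ge0// sqr_ge0.
  rewrite [in RHS](sqrtrM _ (ler0n R T)) sqrtr_sqr (ger0_norm (ltW lam_gt0)); ring.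
apply: ler_wsqrtr; rewrite ler_wpM2l//; apply: ler_pM => //.
  have li1 : 0 <= 1 + (d%:R * l)^-1 by lra.
  exact: mulr_ge0 (mulr_ge0 H0 li1) (ltW dR).
by apply: ler_wpM2r => //; apply: ler_wpM2l => //; lra.
Qed.

End Assembly.

Theorem mainTheorem3 (R : realType) (S delta : R) (hdelta : 0 < delta <= 1) :
  exists C : R, 0 < C /\
  forall (d N K T : nat) (kappa L : R)
    (Theta : set 'cV[R]_d) (theta_star : 'cV[R]_d)
    (disp : measure_display) (Omega : measurableType disp)
    (P : probability Omega R)
    (X : nat -> Omega -> 'M[R]_(d, N)) (Q : nat -> Omega -> {set 'I_N})
    (r : nat -> Omega -> 'I_N -> bool)
    (lam : nat -> R) (theta_hat theta_opt : nat -> Omega -> 'cV[R]_d),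
  (0 < d)%N -> (2 <= K * T)%N ->
  mnl_model K T kappa L S Theta theta_star P X Q r ->
  (forall t, (1 <= t <= T)%N -> lam t = d%:R * ln (K * T)%:R) ->
  (forall w, cb_mnl_run K T Theta S L lam delta (X ^~ w) (Q ^~ w) (r ^~ w)
               (theta_hat ^~ w) (theta_opt ^~ w)) ->
  ((1 - delta)%:E <=
  P [set w | (regret K T theta_star (X ^~ w) (Q ^~ w) <=
        C * (d%:R * Num.sqrt T%:R * ln (K * T)%:R
             + kappa * d%:R ^+ 2 * ln (K * T)%:R ^+ 2))%R])%E.
Proof.
pose G := radius_const S delta; pose Gam := G + 2 * G ^+ 2.
(* [S] may still be negative here and [Gam] may vanish; the [+ 1] keeps [C] positive. *)
pose C := 2 * expR (3 * S) * Num.sqrt (18 * Gam ^+ 2 / curvature S) + 1.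
have C0 : 0 < C by rewrite ltr_wpDl// !mulr_ge0 ?expR_ge0 ?sqrtr_ge0.
exists C; split=> // d N K T kappa L Theta theta_star disp Omega P X Q r lam
  theta_hat theta_opt d0 KT2 model lamE run.
have [delta0 delta1] := andP hdelta.
have l_ge := ln_nat_ge_half (R := R) _ KT2.
have S0 := model_S_ge0 model.
set l := ln (K * T)%:R in l_ge *.
have main_ge0 : 0 <= d%:R * Num.sqrt T%:R * l.
  by rewrite !mulr_ge0 ?sqrtr_ge0//; lra.
have kappa_ge0 : 0 <= kappa * d%:R ^+ 2 * l ^+ 2.
  have k0 := ltW (model_kappa_gt0 model).
  exact: mulr_ge0 (mulr_ge0 k0 (sqr_ge0 _)) (sqr_ge0 _).
set bound := C * _.
have bound_ge : C * (d%:R * Num.sqrt T%:R * l) <= bound.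
  by rewrite ler_wpM2l ?(ltW C0)// lerDl.
(* Without items no softmax bounds [L] from below, but every assortment is empty and the regret is
   0. *)
have [N0|N_gt0] := posnP N.
  rewrite (_ : [set w | _] = setT).
    have -> : P setT = 1%E by exact: probability_setT.
    by rewrite lee_fin; lra.
  apply/seteqP; split=> // w _ /=.
  have mu0 (A0 : 'M[R]_(d, N)) A : mu A0 A theta_star = 0.
    by apply: big1 => i; have := ltn_ord i; rewrite {2}N0.
  rewrite /regret big1 => [|t _]; last by rewrite !mu0 subrr.
  by apply: le_trans bound_ge; rewrite mulr_ge0// ltW.
have K0 : (0 < K)%N by move: KT2; case: (K).
have L4 := softmax_derive_bound_ge L (Ordinal N_gt0) K0 (model_L model).
have [good [mgood Pgood goodE]] :=
  confidence_set_mem model delta lam _ _ hdelta d0 KT2 lamE run L4.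
apply: (le_trans Pgood); apply: le_measure; rewrite ?inE//.
  exact: (measurable_regret_le model).
move=> w /goodE conf /=; apply: le_trans bound_ge.
have G0 : 0 <= G by rewrite /G /radius_const; have := ln_le0 delta1; lra.
have Gam0 : 0 <= Gam by rewrite addr_ge0// mulr_ge0// sqr_ge0.
have betab t : (1 <= t <= T)%N ->
    Defs.beta d K S L lam delta t ^+ 2 <= lam t * Gam ^+ 2.
  move=> tT.
  exact: (beta_sqr_le _ _ _ _ _ _ _ _ d0 KT2 tT (lamE t tT) hdelta S0 L4
            (model_L_le1 model)).
apply: le_trans (regret_bound_const model delta lam _ _ d0 KT2 lamE run Gam w
                   Gam0 conf betab) _.
by rewrite ler_wpM2r// /C lerDl.
Qed.
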